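(* Let $d\geqslant 1$ and let $f\in L^1(\mathbb{R}^d)$ be real-valued and such that $u(x) := f(x) - f\star f(x)\geqslant 0$ for almost every $x\in\mathbb{R}^d$. Suppose that $$\int_{\mathbb{R}^d} |x|^2 u(x)\,dx <\infty \quad\text{and}\quad \int_{\mathbb{R}^d} x\,u(x)\,dx = 0.$$ Then for all $0\leqslant p<1$, $$\int_{\mathbb{R}^d} |x|^p f(x)\,dx <\infty.$$
   Context: For $f\in L^1(\mathbb{R}^d)$, $f\star f(x) = \int_{\mathbb{R}^d} f(x-y)f(y)\,dy$ denotes the convolution of $f$ with itself. Every real integrable $f$ with $f\geqslant f\star f$ almost everywhere is non-negative almost everywhere, so the integral $\int_{\mathbb{R}^d}|x|^pf(x)\,dx$ is well defined in $[0,\infty]$. *)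

(* Defs.v *)
From HB Require Import structures.
From mathcomp Require Import all_boot all_order all_algebra.
From mathcomp Require Import all_classical all_reals all_analysis.

Set Implicit Arguments.
Unset Strict Implicit.
Unset Printing Implicit Defensive.

Import Order.TTheory GRing.Theory Num.Theory.
Import numFieldNormedType.Exports.

Local Open Scope classical_set_scope.
Local Open Scope ring_scope.

(* 'rV[R]_n carries the Borel sigma-algebra of R^n, presented as the product
   sigma-algebra, i.e., the one generated by the coordinate projections. *)
Definition rV_display : measure_display.
Proof. exact: default_measure_display. Qed.

Section measurable_rV.
Context {R : realType} (n : nat).

Definition coord_rV (i : 'I_n) (x : 'rV[R]_n) : measurableTypeR R := x ord0 i.

Let rV_set0 : g_sigma_preimage coord_rV set0.
Proof. exact: sigma_algebra0. Qed.

Let rV_setC A : g_sigma_preimage coord_rV A -> g_sigma_preimage coord_rV (~` A).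
Proof. exact: sigma_algebraC. Qed.

Let rV_bigcup (F : (set 'rV[R]_n)^nat) :
  (forall i, g_sigma_preimage coord_rV (F i)) ->
  g_sigma_preimage coord_rV (\bigcup_i (F i)).
Proof. exact: sigma_algebra_bigcup. Qed.

HB.instance Definition _ := @isMeasurable.Build rV_display
  'rV[R]_n (g_sigma_preimage coord_rV) rV_set0 rV_setC rV_bigcup.

End measurable_rV.

Section cons_rV.
Context {R : realType}.

Lemma measurable_coord_rV n (i : 'I_n) :
  measurable_fun [set: 'rV[R]_n] (coord_rV i).
Proof.
move=> _ Y mY; rewrite setTI; apply: sub_sigma_algebra => /=.
rewrite -bigcup_seq/=; exists i => /=; first by rewrite mem_index_enum.
by exists Y => //; rewrite setTI.
Qed.

Lemma measurable_rVP d (T : measurableType d) n (f : T -> 'rV[R]_n) :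
  measurable_fun [set: T] f <->
  forall i, measurable_fun [set: T] (coord_rV i \o f).
Proof.
split=> [mf i|mf]; first exact: measurableT_comp (measurable_coord_rV i) mf.
have : g_sigma_preimage (fun i => coord_rV i \o f) `<=` measurable.
  apply: smallest_sub; first exact: sigma_algebra_measurable.
  by rewrite -bigcup_seq => A [i _] [B mB <-]; exact: mf.
rewrite g_sigma_preimage_comp => prefS _ A mA.
by apply: prefS; exists A.
Qed.

Definition cons_rV n (p : measurableTypeR R * 'rV[R]_n) : 'rV[R]_n.+1 :=
  row_mx (const_mx p.1 : 'rV[R]_1) p.2.

Lemma coord_cons_rV0 n : coord_rV ord0 \o @cons_rV n = fst.
Proof.
apply/funext => p; rewrite /coord_rV /cons_rV /=.
have -> : ord0 = lshift n (ord0 : 'I_1) by exact: val_inj.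
by rewrite (@row_mxEl _ 1 1 n) mxE.
Qed.

Lemma coord_cons_rVS n (i : 'I_n) :
  coord_rV (lift ord0 i) \o @cons_rV n = coord_rV i \o snd.
Proof.
apply/funext => p; rewrite /coord_rV /cons_rV /=.
have -> : lift ord0 i = rshift 1 i by exact: val_inj.
by rewrite (@row_mxEr _ 1 1 n).
Qed.

Lemma measurable_cons_rV n : measurable_fun setT (@cons_rV n).
Proof.
apply/measurable_rVP => i; have [j ->|->] := unliftP ord0 i.
  by rewrite coord_cons_rVS; exact: measurableT_comp (measurable_coord_rV j) _.
by rewrite coord_cons_rV0.
Qed.

End cons_rV.

Section lebesgue_rV_succ.
Context {R : realType} (n : nat).
Variable mu : {sigma_finite_measure set 'rV[R]_n -> \bar R}.
Local Open Scope ereal_scope.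

Definition lebesgue_rV_succ : set 'rV[R]_n.+1 -> \bar R :=
  pushforward (lebesgue_measure \x mu) (@cons_rV R n).

Let lebesgue_rV_succ0 : lebesgue_rV_succ set0 = 0.
Proof. by rewrite /lebesgue_rV_succ /pushforward preimage_set0 measure0. Qed.

Let lebesgue_rV_succ_ge0 A : 0 <= lebesgue_rV_succ A.
Proof. exact: (measure_ge0 (lebesgue_measure \x mu)). Qed.

Let lebesgue_rV_succ_sigma_additive : semi_sigma_additive lebesgue_rV_succ.
Proof.
move=> F mF tF mUF; rewrite /lebesgue_rV_succ.
by apply: measure_semi_sigma_additive => //; exact: measurable_cons_rV.
Qed.

HB.instance Definition _ := isMeasure.Build _ _ _ lebesgue_rV_succ
  lebesgue_rV_succ0 lebesgue_rV_succ_ge0 lebesgue_rV_succ_sigma_additive.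

(* The sigma-finiteness of lebesgue_measure \x mu is reproved here because the
   library's sigma-finite instance for \x is shadowed by the one for
   subprobabilities. *)
Let lebesgue_rV_succ_sigma_finite : sigma_finite setT lebesgue_rV_succ.
Proof.
have [F FT Foo] : sigma_finite setT (lebesgue_measure \x mu).
  have /sigma_finiteP[F [TF ndF Foo]] := sigma_finiteT (@lebesgue_measure R).
  have /sigma_finiteP[G [TG ndG Goo]] := sigma_finiteT mu.
  exists (fun k => F k `*` G k) => [|k].
    rewrite -setXTT TF TG; apply/seteqP; split=> [[x y] /= [[i _ Fx] [j _ Gy]]|].
      exists (maxn i j) => //; split.
        by move: x Fx; exact/subsetPset/ndF/leq_maxl.
      by move: y Gy; exact/subsetPset/ndG/leq_maxr.
    by move=> [x y] [k _ []/= ? ?]; split; exists k.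
  have [? ?] := Foo k; have [? ?] := Goo k; split; first exact: measurableX.
  by rewrite product_measure1E// lte_mul_pinfty// ge0_fin_numE.
pose g (x : 'rV[R]_n.+1) : measurableTypeR R * 'rV[R]_n :=
  (coord_rV ord0 x, \row_i coord_rV (lift ord0 i) x).
have consK : cancel (@cons_rV R n) g.
  move=> p; rewrite /g [RHS]surjective_pairing; congr pair.
    by rewrite -[LHS]/((coord_rV ord0 \o @cons_rV R n) p) coord_cons_rV0.
  apply/rowP => i; rewrite mxE.
  by rewrite -[LHS]/((coord_rV _ \o @cons_rV R n) p) coord_cons_rVS.
have mg : measurable_fun setT g.
  apply: measurable_fun_pair; first exact: measurable_coord_rV.
  apply/measurable_rVP => i.
  apply: (eq_measurable_fun (coord_rV (lift ord0 i))).
    by move=> x _; rewrite /= /coord_rV mxE.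
  exact: measurable_coord_rV.
exists (fun k => g @^-1` F k) => [|k].
  by rewrite -preimage_bigcup -FT preimage_setT.
have [mFk Fkoo] := Foo k; split.
  by rewrite -[X in measurable X]setTI; exact: mg.
rewrite /lebesgue_rV_succ /pushforward -comp_preimage.
by rewrite (_ : g \o _ = id)//; apply/funext => p; exact: consK.
Qed.

HB.instance Definition _ := Measure_isSigmaFinite.Build _ _ _ lebesgue_rV_succ
  lebesgue_rV_succ_sigma_finite.

End lebesgue_rV_succ.

Fixpoint lebesgue_rV {R : realType} (n : nat) :
    {sigma_finite_measure set 'rV[R]_n -> \bar R} :=
  match n with
  | 0 => \d_(0 : 'rV[R]_0)
  | n'.+1 => lebesgue_rV_succ (lebesgue_rV n')
  end.

(* This equation on boxes characterizes Lebesgue measure on R^n. *)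
Lemma lebesgue_rV_box {R : realType} n (A : 'I_n -> set (measurableTypeR R)) :
  (forall i, measurable (A i)) ->
  lebesgue_rV n [set x | forall i, A i (x ord0 i)] =
  (\prod_(i < n) lebesgue_measure (A i))%E.
Proof.
elim: n A => [|n IHn] A mA.
  by rewrite big_ord0 /= diracE mem_set// => -[].
rewrite big_ord_recl /= /lebesgue_rV_succ /pushforward -IHn//.
have mB : measurable [set x : 'rV[R]_n | forall i, A (lift ord0 i) (x ord0 i)].
  rewrite [X in measurable X](_ : _ =
    \bigcap_(i in [set: 'I_n]) (coord_rV i @^-1` A (lift ord0 i))).
    apply: fin_bigcap_measurable => // i _.
    by rewrite -[X in measurable X]setTI; exact: measurable_coord_rV.
  by apply/seteqP; split=> [x Ax i _|x Ax i]; exact: Ax.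
rewrite -product_measure1E//; congr (_ _).
have E0 (p : measurableTypeR R * 'rV[R]_n) : cons_rV p ord0 ord0 = p.1.
  by rewrite -[LHS]/((coord_rV ord0 \o @cons_rV R n) p) coord_cons_rV0.
have ES (p : measurableTypeR R * 'rV[R]_n) i :
    cons_rV p ord0 (lift ord0 i) = p.2 ord0 i.
  by rewrite -[LHS]/((coord_rV (lift ord0 i) \o @cons_rV R n) p) coord_cons_rVS.
apply/seteqP; split=> [p Ap|p [Ap0 ApS] i] /=.
  by split => [|i]; [rewrite -E0|rewrite /= -ES].
by have [j ->|->] := unliftP ord0 i; rewrite ?ES ?E0.
Qed.

(* The norm the library puts on 'rV[R]_n is the sup norm; this is the
   Euclidean one. *)
Definition enorm {R : realType} n (x : 'rV[R]_n) : R :=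
  Num.sqrt (\sum_(i < n) x ord0 i ^+ 2).

(* For integrable f and g the integral converges absolutely for almost every x;
   at the exceptional points the value is the junk value of Rintegral. *)
Definition convolution {R : realType} n (f g : 'rV[R]_n -> R) (x : 'rV[R]_n) : R :=
  \int[lebesgue_rV n]_y (f (x - y) * g y).

(* Main.v *)
(* Write [F^] for the Fourier transform and put [u := f - f * f >= 0].
   Integrating gives [int u = a - a ^ 2 <= 1/4] with [a := int f], so the monotone
   iteration [g_(k+1) := u + g_k * g_k] from [0] stays below mass 1/2 and converges
   to a nonnegative integrable [g] with [g = u + g * g].
   Then [(1 - 2 f^) ^ 2 = 1 - 4 u^ = (1 - 2 g^) ^ 2], and [1 - 4 u^] vanishes at most
   at the origin, since hyperplanes are null sets. By continuity, on every ray from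
   the origin either [f^ = g^] throughout or [f^ + g^ = 1] throughout; the latter is
   impossible because [cos ^ k (t) cos ((k + 1) t)] tends to [0] for almost every
   [t]. Hence [f^ = g^], and [f = g >= 0] almost everywhere.
   Finally [1 - 4 u^] is within [O(|xi| ^ 2)] of its value at [0], because [u] is
   centered with finite second moment, and [1 - 2 f^] is its square root with
   nonnegative real part. So [int f (1 - cos (k x_i)) = O(|k|)], and summing this
   over [k = 2 ^ -m] with weights [2 ^ (m p)] bounds the moment of order [p < 1]. *)

From HB Require Import structures.
Require Import Defs.
From mathcomp Require Import all_boot all_order all_algebra.
From mathcomp Require Import all_classical all_reals all_analysis.
From mathcomp Require Import measurable_realfun ring lra.

Set Implicit Arguments.
Unset Strict Implicit.
Unset Printing Implicit Defensive.

Import Order.TTheory GRing.Theory Num.Theory.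
Import numFieldNormedType.Exports.

Local Open Scope classical_set_scope.
Local Open Scope ring_scope.

(** * Invariance of Lebesgue measure on R^n and null hyperplanes *)

Section reflection.
Context {R : realType}.

(** Reflection maps []b, c]] onto [[a - c, a - b[], of the same length, and Lebesgue measure is
    determined by its values on half-open intervals. *)
Lemma lebesgue_measure_reflect (a : R) (A : set (measurableTypeR R)) :
  measurable A ->
  lebesgue_measure ((fun x : measurableTypeR R => a - x : measurableTypeR R) @^-1` A)
  = lebesgue_measure A.
Proof.
move=> mA; pose s : measurableTypeR R -> measurableTypeR R := fun x => a - x.
have ms : measurable_fun setT s by apply: measurable_funB.
rewrite -[LHS]/(pushforward lebesgue_measure s A).
apply/esym/lebesgue_measure_unique => // _ [[b c]] _ <- /=.
rewrite /pushforward (_ : s @^-1` _ = `[a - c, a - b[%classic).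
  rewrite !lebesgue_measure_itv/= !lte_fin ltrD2l ltrN2 -!EFinB.
  by case: ifP => // _; congr EFin; lra.
apply/seteqP; split=> x; rewrite /s /= !in_itv /=; lra.
Qed.

Lemma measurable_subl_rV n (a : 'rV[R]_n) :
  measurable_fun setT (fun x : 'rV[R]_n => a - x).
Proof.
apply/measurable_rVP => i.
apply: (eq_measurable_fun (fun x => coord_rV i a - coord_rV i x)).
  by move=> x _; rewrite /coord_rV /= !mxE.
by apply: measurable_funB => //; exact: measurable_coord_rV.
Qed.

Lemma measurable_subr_rV n (a : 'rV[R]_n) :
  measurable_fun setT (fun x : 'rV[R]_n => x - a).
Proof.
apply/measurable_rVP => i.
apply: (eq_measurable_fun (fun x => coord_rV i x - coord_rV i a)).
  by move=> x _; rewrite /coord_rV /= !mxE.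
by apply: measurable_funB => //; exact: measurable_coord_rV.
Qed.

Lemma cons_rV_ord0 n (p : measurableTypeR R * 'rV[R]_n) :
  cons_rV p ord0 ord0 = p.1.
Proof. by rewrite -[LHS]/((coord_rV ord0 \o @cons_rV R n) p) coord_cons_rV0. Qed.

Lemma cons_rV_lift n (p : measurableTypeR R * 'rV[R]_n) i :
  cons_rV p ord0 (lift ord0 i) = p.2 ord0 i.
Proof.
by rewrite -[LHS]/((coord_rV (lift ord0 i) \o @cons_rV R n) p) coord_cons_rVS.
Qed.

(** Induction on the dimension: through [cons_rV] the reflection acts separately on the first
    coordinate and on the others, and a product measure is determined by rectangles. *)
Lemma lebesgue_rV_reflect n (a : 'rV[R]_n) (A : set 'rV[R]_n) :
  measurable A -> lebesgue_rV n ((fun x => a - x) @^-1` A) = lebesgue_rV n A.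
Proof.
elim: n a A => [|n IHn] a A mA.
  by congr (lebesgue_rV 0 _); apply/seteqP; split=> x /=; rewrite !(thinmx0 x)
    (thinmx0 (a - _)).
pose s (p : measurableTypeR R * 'rV[R]_n) : measurableTypeR R * 'rV[R]_n :=
  (coord_rV ord0 a - p.1, (\row_i coord_rV (lift ord0 i) a) - p.2).
have sE p : a - cons_rV p = cons_rV (s p).
  apply/rowP => i; rewrite 2!mxE.
  have [j ->|->] := unliftP ord0 i; last by rewrite !cons_rV_ord0.
  by rewrite !cons_rV_lift /= !mxE.
have ms : measurable_fun setT s.
  apply: measurable_fun_pair; first by apply: measurable_funB.
  by apply: (measurableT_comp (measurable_subl_rV _)).
have mcA : measurable (@cons_rV R n @^-1` A).
  by rewrite -[X in measurable X]setTI; exact: measurable_cons_rV.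
rewrite /= /lebesgue_rV_succ /pushforward.
rewrite (_ : _ @^-1` _ = s @^-1` (@cons_rV R n @^-1` A)); last first.
  by apply/seteqP; split=> p /=; rewrite sE.
rewrite -[LHS]/(pushforward (lebesgue_measure \x lebesgue_rV n)%E s _).
apply/esym/product_measure_unique => // B C mB mC.
pose s1 : measurableTypeR R -> measurableTypeR R := fun x => coord_rV ord0 a - x.
pose s2 (x : 'rV[R]_n) := (\row_i coord_rV (lift ord0 i) a) - x.
have mB' : measurable (s1 @^-1` B).
  by rewrite -[X in measurable X]setTI; apply: measurable_funB.
have mC' : measurable (s2 @^-1` C).
  by rewrite -[X in measurable X]setTI; exact: measurable_subl_rV.
transitivity ((lebesgue_measure \x lebesgue_rV n)%E ((s1 @^-1` B) `*` (s2 @^-1` C))) => //.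
rewrite product_measure1E//; congr (_ * _)%E; last exact: IHn.
exact: lebesgue_measure_reflect.
Qed.

Lemma ge0_integral_reflect n (a : 'rV[R]_n) (F : 'rV[R]_n -> \bar R) :
  measurable_fun setT F -> (forall x, 0 <= F x)%E ->
  (\int[lebesgue_rV n]_x F (a - x)%R = \int[lebesgue_rV n]_x F x)%E.
Proof.
move=> mF F0.
rewrite -(@ge0_integral_pushforward _ _ _ _ _ _ (measurable_subl_rV a) (lebesgue_rV n) setT F)//.
apply: eq_measure_integral => [|? A mA _]; first exact: measurable_subl_rV.
exact: lebesgue_rV_reflect.
Qed.

Lemma ge0_integral_translate n (a : 'rV[R]_n) (F : 'rV[R]_n -> \bar R) :
  measurable_fun setT F -> (forall x, 0 <= F x)%E ->
  (\int[lebesgue_rV n]_x F (x - a)%R = \int[lebesgue_rV n]_x F x)%E.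
Proof.
move=> mF F0.
have mFa : measurable_fun setT (fun x : 'rV[R]_n => F (x - a)).
  exact: (measurableT_comp mF (measurable_subr_rV a)).
(* Reflecting the left side in [0] and the right side in [- a] produces the same integrand. *)
rewrite -(ge0_integral_reflect 0 mFa)// -[RHS](ge0_integral_reflect (- a)) //.
by apply: eq_integral => x _; rewrite sub0r addrC.
Qed.

Lemma integral_translate n (a : 'rV[R]_n) (F : 'rV[R]_n -> \bar R) :
  measurable_fun setT F ->
  (\int[lebesgue_rV n]_x F (x - a)%R = \int[lebesgue_rV n]_x F x)%E.
Proof.
move=> mF; rewrite integralE [RHS]integralE; congr (_ - _)%E.
  rewrite -(ge0_integral_translate a (measurable_funepos mF) (funepos_ge0 F)).
  by apply: eq_integral => x _; rewrite !funeposE.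
rewrite -(ge0_integral_translate a (measurable_funeneg mF) (funeneg_ge0 F)).
by apply: eq_integral => x _; rewrite !funenegE.
Qed.

Lemma negligible_reflect n (a : 'rV[R]_n) (N : set 'rV[R]_n) :
  (lebesgue_rV n).-negligible N ->
  (lebesgue_rV n).-negligible ((fun x => a - x) @^-1` N).
Proof.
move=> [B [mB B0 NB]]; exists ((fun x => a - x) @^-1` B); split.
- by rewrite -[X in measurable X]setTI; exact: measurable_subl_rV.
- by rewrite -[RHS]B0; exact: lebesgue_rV_reflect.
- by move=> x /NB.
Qed.

End reflection.

Section hyperplane.
Context {R : realType}.

Definition dot_rV n (xi x : 'rV[R]_n) : R := \sum_i xi ord0 i * x ord0 i.

Lemma measurable_dot_rV n (xi : 'rV[R]_n) : measurable_fun setT (dot_rV xi).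
Proof.
apply: measurable_sum => i.
by apply: measurable_funM => //; exact: measurable_coord_rV.
Qed.

Lemma dot_rVDr n (xi x y : 'rV[R]_n) : dot_rV xi (x + y) = dot_rV xi x + dot_rV xi y.
Proof. by rewrite /dot_rV -big_split; apply: eq_bigr => i _; rewrite mxE mulrDr. Qed.

Lemma dot_rVDl n (xi eta x : 'rV[R]_n) : dot_rV (xi + eta) x = dot_rV xi x + dot_rV eta x.
Proof. by rewrite /dot_rV -big_split; apply: eq_bigr => i _; rewrite mxE mulrDl. Qed.

Lemma dot_rVZl n (k : R) (xi x : 'rV[R]_n) : dot_rV (k *: xi) x = k * dot_rV xi x.
Proof. by rewrite /dot_rV mulr_sumr; apply: eq_bigr => i _; rewrite mxE mulrA. Qed.

Lemma dot_rVNl n (xi x : 'rV[R]_n) : dot_rV (- xi) x = - dot_rV xi x.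
Proof. by rewrite -scaleN1r dot_rVZl mulN1r. Qed.

Lemma dot_rV_delta n (i : 'I_n) (x : 'rV[R]_n) : dot_rV (delta_mx ord0 i) x = x ord0 i.
Proof.
rewrite /dot_rV (bigD1 i)//= mxE !eqxx mul1r big1 ?addr0// => j ji.
by rewrite mxE (negbTE ji) andbF mul0r.
Qed.

(** Induction on the dimension by slicing along the first coordinate. If the remaining coefficients
    [eta] vanish, the hyperplane is a point times the whole space; otherwise every slice is a
    hyperplane of lower dimension. *)
Lemma lebesgue_rV_hyperplane n (xi : 'rV[R]_n) (c : R) : xi != 0 ->
  lebesgue_rV n [set x | dot_rV xi x = c] = 0%E.
Proof.
elim: n xi c => [|n IHn] xi c xi0; first by rewrite (thinmx0 xi) eqxx in xi0.
pose eta : 'rV[R]_n := \row_i xi ord0 (lift ord0 i).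
have dE p : dot_rV xi (cons_rV p) = xi ord0 ord0 * p.1 + dot_rV eta p.2.
  rewrite /dot_rV big_ord_recl cons_rV_ord0; congr (_ + _).
  by apply: eq_bigr => i _; rewrite cons_rV_lift [in RHS]mxE.
rewrite /= /lebesgue_rV_succ /pushforward.
rewrite (_ : _ @^-1` _ = [set p | xi ord0 ord0 * p.1 + dot_rV eta p.2 = c]); last first.
  by apply/seteqP; split=> p /=; rewrite dE.
have [eta0|eta0] := eqVneq eta 0.
  have xi00 : xi ord0 ord0 != 0.
    apply: contra xi0 => /eqP x0; apply/eqP/rowP => i; rewrite mxE.
    have [j ->|->//] := unliftP ord0 i.
    by have /rowP/(_ j) := eta0; rewrite !mxE.
  rewrite (_ : [set p | _] = [set c / xi ord0 ord0] `*` setT).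
    rewrite product_measure1E//.
    by rewrite [X in (X * _)%E]lebesgue_measure_set1 mul0e.
  apply/seteqP; split=> [[x y]|[x y]] /=.
    rewrite eta0 /dot_rV big1 ?addr0; last by move=> i _; rewrite mxE mul0r.
    by move=> <-; split => //; rewrite mulrC mulKf.
  move=> [-> _]; rewrite eta0 /dot_rV big1 ?addr0; last by move=> i _; rewrite mxE mul0r.
  by rewrite mulrC mulfVK.
rewrite /= /product_measure1; apply: integral0_eq => x _ /=.
rewrite -[RHS](IHn eta (c - xi ord0 ord0 * x) eta0); congr (lebesgue_rV n _).
apply/seteqP; split=> y; rewrite /xsection /= ?inE /= ?mem_setE; lra.
Qed.

Lemma ae_dot_rV_neq n (xi : 'rV[R]_n) (c : R) : xi != 0 ->
  {ae lebesgue_rV n, forall x, dot_rV xi x != c}.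
Proof.
move=> xi0; exists [set x | dot_rV xi x = c]; split.
- rewrite -[X in measurable X]setTI.
  exact: (measurable_dot_rV xi measurableT (measurable_set1 c)).
- exact: lebesgue_rV_hyperplane.
- by move=> x /= /negP; rewrite negbK => /eqP.
Qed.

End hyperplane.

(** * Bounded multipliers and dominated convergence *)

Section bounded_multiplication.
Context d (T : measurableType d) {R : realType}.
Variable mu : {measure set T -> \bar R}.
Implicit Types (h v : T -> R) (M : R).

Lemma integrable_mulr_bounded M h v : mu.-integrable setT (EFin \o h) ->
  measurable_fun setT v -> (forall x, `|v x| <= M) ->
  mu.-integrable setT (EFin \o (fun x => h x * v x)).
Proof.
move=> ih mv vM; have mh := measurable_int _ ih.
apply: (le_integrable measurableT _ _ (integrableZl measurableT M ih)).
  by apply/measurable_EFinP/measurable_funM => //; exact/measurable_EFinP.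
move=> x _ /=; rewrite lee_fin !normrM mulrC ler_wpM2r//.
by rewrite (le_trans (vM x))// ler_norm.
Qed.

Lemma Rintegral_dominated_cvg h (v_ : nat -> T -> R) v :
  mu.-integrable setT (EFin \o h) ->
  (forall n, measurable_fun setT (v_ n)) -> measurable_fun setT v ->
  (forall n x, `|v_ n x| <= 1) ->
  {ae mu, forall x, v_ ^~ x @ \oo --> v x} ->
  \int[mu]_x (h x * v_ n x) @[n --> \oo] --> \int[mu]_x (h x * v x).
Proof.
move=> ih mv_ mv v1 vv.
have mh := measurable_int _ ih.
have mhM w : measurable_fun setT w -> measurable_fun setT (fun x => (h x * w x)%:E).
  by move=> mw; apply/measurable_EFinP/measurable_funM => //; exact/measurable_EFinP.
have hvv : {ae mu, forall x, setT x -> (h x * v_ n x)%:E @[n --> \oo] --> (h x * v x)%:E}.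
  apply: filterS vv => x vx _.
  apply: cvg_EFin; first exact: nearW.
  by apply: cvgM; [exact: cvg_cst|exact: vx].
have hle : {ae mu, forall x n, setT x -> (`|(h x * v_ n x)%:E| <= `|(h x)%:E|)%E}.
  by apply: aeW => x n _ /=; rewrite lee_fin normrM ler_piMr.
have [ihv _ H] := dominated_convergence measurableT (fun n => mhM _ (mv_ n))
  (mhM _ mv) hvv (integrable_abse ih) hle.
by apply: fine_cvg; rewrite fineK //; exact: integrable_fin_num.
Qed.

Lemma ae_eq_Rintegral (f g : T -> R) :
  measurable_fun setT f -> measurable_fun setT g ->
  {ae mu, forall x, f x = g x} -> \int[mu]_x f x = \int[mu]_x g x.
Proof.
move=> mf mg fg; congr fine; apply: ae_eq_integral => //; try exact/measurable_EFinP.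
by apply: filterS fg => x -> _.
Qed.

End bounded_multiplication.

(** * Zeros of the sine of an affine form *)

Section sine_zeros.
Context {R : realType}.

Lemma sin_eq0_nat (t : R) : sin t = 0 -> exists n : nat, `|t| = n%:R * pi.
Proof.
(* The witness is the integer part of [|t| / pi]; the remainder [s] lies in [[0, pi[] and its sine
   vanishes, so [s = 0]. *)
move=> st0; exists (Num.truncn (`|t| / pi)); set k := Num.truncn _.
have t0 : 0 <= `|t| / pi by rewrite divr_ge0// pi_ge0.
have /andP[kl ku] := truncn_itv t0.
have snt : sin `|t| = 0 by case: (ger0P t) => _ //; rewrite sinN st0 oppr0.
set s := `|t| - k%:R * pi; have tE : `|t| = s + pi *+ k.
  by rewrite -mulr_natl subrK.
have ss0 : sin s = 0.
  have := alternatingn (@sinDpi R) k s; rewrite -tE snt => /esym/eqP.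
  by rewrite mulf_eq0 signr_eq0 => /eqP.
have s0 : 0 <= s by rewrite subr_ge0 -ler_pdivlMr// pi_gt0.
have spi : s < pi.
  rewrite ltrBlDr -[ltRHS](_ : k.+1%:R * pi = _) -?ltr_pdivrMr ?pi_gt0//.
  by rewrite -addn1 natrD mulrDl mul1r addrC.
move: s0; rewrite le_eqVlt => /predU1P[/esym/eqP|s0].
  by rewrite subr_eq0 => /eqP.
by have := @sin_gt0_pi R s; rewrite s0 spi ss0 ltxx => /(_ isT).
Qed.

(** The exceptional set lies in two countable families of parallel hyperplanes, one for each sign
    [s] of the argument. *)
Lemma ae_sin_dot_rV_neq0 n (xi : 'rV[R]_n) c : xi != 0 ->
  {ae lebesgue_rV n, forall x, sin (dot_rV xi x + c) != 0}.
Proof.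
move=> xi0.
have H (s : bool) : (lebesgue_rV n).-negligible
    (\bigcup_k [set x | dot_rV xi x = (-1) ^+ s * (k%:R * pi) - c]).
  apply: negligible_bigcup => k.
  have := ae_dot_rV_neq ((-1) ^+ s * (k%:R * pi) - c) xi0.
  apply: negligibleS => x /=.
  by move=> -> ; rewrite eqxx.
apply: (negligibleS _ (negligibleU (H false) (H true))) => x /=.
move/negP; rewrite negbK => /eqP /sin_eq0_nat[k].
have [_ kE|_ kE] := ger0P (dot_rV xi x + c).
  by left; exists k => //=; rewrite mul1r -kE addrK.
by right; exists k => //=; rewrite expr1 mulN1r -kE opprK addrK.
Qed.

End sine_zeros.

(** * Injectivity of the Fourier transform *)

Section injectivity.
Context {R : realType} (n : nat).
Local Notation mu := (@lebesgue_rV R n).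
Implicit Types (h v : 'rV[R]_n -> R) (xi x : 'rV[R]_n).

Lemma measurable_cos_dot_rV xi c :
  measurable_fun setT (fun x => cos (dot_rV xi x + c)).
Proof.
have mc : measurable_fun setT (@cos R).
  by apply: continuous_measurable_fun; exact: continuous_cos.
apply: (measurableT_comp mc).
by apply: measurable_funD => //; exact: measurable_dot_rV.
Qed.

(** A real encoding of [h^ = 0]: the phase [c] covers cosine and sine at once and makes the family
    of test functions stable under product-to-sum formulas. *)
Definition fourier_null h :=
  forall xi c, \int[mu]_x (h x * cos (dot_rV xi x + c)) = 0.

(* The sets whose indicator is a null multiplier turn out to form a sigma-algebra
   containing the half-spaces, so a function with null Fourier transform has zero
   integral over every measurable set. *)
Definition null_multiplier v := [/\ measurable_fun setT v,
  forall x, 0 <= v x <= 1 &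
  forall h, mu.-integrable setT (EFin \o h) -> fourier_null h ->
    fourier_null (fun x => h x * v x)].

Let norm_mult v : null_multiplier v -> forall x, `|v x| <= 1.
Proof. by move=> [_ v01 _] x; have /andP[v0 v1] := v01 x; rewrite ger0_norm. Qed.

Let integrable_mult h v : null_multiplier v ->
  mu.-integrable setT (EFin \o h) ->
  mu.-integrable setT (EFin \o (fun x => h x * v x)).
Proof.
by move=> Mv ih; have [mv _ _] := Mv; exact: integrable_mulr_bounded ih mv (norm_mult Mv).
Qed.

Let integrable_cos h xi c : mu.-integrable setT (EFin \o h) ->
  mu.-integrable setT (EFin \o (fun x => h x * cos (dot_rV xi x + c))).
Proof.
move=> ih; apply: (integrable_mulr_bounded ih (measurable_cos_dot_rV xi c)) => x.
exact: cos_max.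
Qed.

Lemma null_multiplierM v w : null_multiplier v -> null_multiplier w ->
  null_multiplier (fun x => v x * w x).
Proof.
move=> Mv Mw; have [mv v01 Hv] := Mv; have [mw w01 Hw] := Mw; split.
- exact: measurable_funM.
- move=> x; have /andP[? ?] := v01 x; have /andP[? ?] := w01 x.
  by rewrite mulr_ge0// mulr_ile1.
- move=> h ih h0 xi c; have := Hw _ (integrable_mult Mv ih) (Hv _ ih h0) xi c.
  by under eq_Rintegral do rewrite -(mulrA (h _)).
Qed.

Lemma null_multiplier_onem v : null_multiplier v ->
  null_multiplier (fun x => 1 - v x).
Proof.
move=> Mv; have [mv v01 Hv] := Mv; split.
- exact: measurable_funB.
- by move=> x; have /andP[? ?] := v01 x; lra.
- move=> h ih h0 xi c.
  under eq_Rintegral do rewrite mulrBr mulr1 mulrBl.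
  rewrite RintegralB//; [|exact: integrable_cos|]; last first.
    exact: (integrable_cos _ _ (integrable_mult Mv ih)).
  by rewrite h0 (Hv _ ih h0) subr0.
Qed.

Lemma null_multiplier1 : null_multiplier (fun=> 1).
Proof.
split => [|x|h ih h0 xi c]; [exact: measurable_cst|by rewrite ler01 lexx|].
by under eq_Rintegral do rewrite mulr1.
Qed.

Lemma null_multiplierX v k : null_multiplier v ->
  null_multiplier (fun x => v x ^+ k).
Proof.
move=> Mv; elim: k => [|k IHk]; first exact: null_multiplier1.
rewrite [X in null_multiplier X](_ : _ = (fun x => v x * v x ^+ k)).
  exact: null_multiplierM.
by apply/funext => x; rewrite exprS.
Qed.

(** Dominated convergence, with majorant [|h|]. *)
Lemma null_multiplier_lim (v_ : nat -> 'rV[R]_n -> R) v :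
  (forall k, null_multiplier (v_ k)) -> measurable_fun setT v ->
  (forall x, 0 <= v x <= 1) ->
  {ae mu, forall x, v_ ^~ x @ \oo --> v x} -> null_multiplier v.
Proof.
move=> Mv mv v01 vv; split => // h ih h0 xi c.
have H := Rintegral_dominated_cvg (integrable_cos xi c ih)
  (fun k => let: And3 mvk _ _ := Mv k in mvk) mv (fun k => norm_mult (Mv k)) vv.
under eq_Rintegral do rewrite mulrAC.
rewrite -(cvg_lim _ H)// (_ : (fun k => _) = cst 0) ?lim_cst//.
apply/funext => k; have [_ _ Hk] := Mv k; rewrite /= -[RHS](Hk h ih h0 xi c).
by apply: eq_Rintegral => x _; rewrite mulrAC.
Qed.

(** Multiplying a test cosine of frequency [eta] by this one yields cosines of frequencies [eta],
    [eta + xi] and [eta - xi]. The affine change brings the values into [[0, 1]]. *)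
Lemma null_multiplier_cos xi c :
  null_multiplier (fun x => (1 + cos (dot_rV xi x + c)) / 2).
Proof.
split.
- apply: measurable_funM => //; apply: measurable_funD => //.
  exact: measurable_cos_dot_rV.
- move=> x; have := cos_geN1 (dot_rV xi x + c); have := cos_le1 (dot_rV xi x + c).
  lra.
- move=> h ih h0 eta b.
  pose C1 x := h x * cos (dot_rV eta x + b).
  pose C2 x := h x * cos (dot_rV (eta + xi) x + (b + c)).
  pose C3 x := h x * cos (dot_rV (eta - xi) x + (b - c)).
  have cE x : h x * ((1 + cos (dot_rV xi x + c)) / 2) * cos (dot_rV eta x + b) =
      2^-1 * C1 x + (4^-1 * C2 x + 4^-1 * C3 x).
    rewrite /C1 /C2 /C3 !dot_rVDl dot_rVNl.
    rewrite (_ : _ + (b + c) = (dot_rV eta x + b) + (dot_rV xi x + c)); last by ring.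
    rewrite (_ : _ + (b - c) = (dot_rV eta x + b) - (dot_rV xi x + c)); last by ring.
    by move: (_ + b) (_ + c) => s t; rewrite cosD cosB; field.
  have i1 : mu.-integrable setT (EFin \o (fun x => 2^-1 * C1 x)).
    exact: (integrableZl measurableT _ (integrable_cos _ _ ih)).
  have i2 : mu.-integrable setT (EFin \o (fun x => 4^-1 * C2 x)).
    exact: (integrableZl measurableT _ (integrable_cos _ _ ih)).
  have i3 : mu.-integrable setT (EFin \o (fun x => 4^-1 * C3 x)).
    exact: (integrableZl measurableT _ (integrable_cos _ _ ih)).
  under eq_Rintegral do rewrite cE.
  rewrite RintegralD//; last exact: (integrableD measurableT i2 i3).
  rewrite RintegralD// !RintegralZl//; try exact: integrable_cos.
  by rewrite !h0 !mulr0 !addr0.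
Qed.

(** These polynomials in [w] sharpen to a step at 1/2, as in elementary proofs of the
    Stone-Weierstrass theorem: Bernoulli-type bounds give [1 - (2 w) ^ k] from below and
    [(2 w) ^- k] from above. At [w = 1/2] itself the limit is [exp (-1)], hence the exclusion. *)
Lemma cvg_threshold (w : R) : 0 <= w <= 1 -> w != 2^-1 ->
  (1 - w ^+ k) ^+ (2 ^ k)%N @[k --> \oo] --> ((w < 2^-1)%R%:R : R).
Proof.
move=> /andP[w0 w1] wn.
have wk k : 0 <= w ^+ k <= 1 by rewrite exprn_ge0//= exprn_ile1.
have bern (y : R) m : 0 <= y <= 1 -> 1 - m%:R * y <= (1 - y) ^+ m.
  move=> /andP[y0 y1]; elim: m => [|m IHm]; first by rewrite mul0r subr0 expr0.
  rewrite exprS -natr1; apply: (@le_trans _ _ ((1 - y) * (1 - m%:R * y))).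
    have : 0 <= m%:R * (y * y) by rewrite !mulr_ge0.
    by rewrite mulrDl mul1r mulrBr mulrBl mul1r mulr1; nra.
  by rewrite ler_wpM2l// subr_ge0.
(* Combine [m y <= (1 + y) ^ m] with [(1 - y) (1 + y) <= 1]. *)
have bern' (y : R) m : 0 <= y <= 1 -> (1 - y) ^+ m * (m%:R * y) <= 1.
  move=> /andP[y0 y1].
  have h1 : m%:R * y <= (1 + y) ^+ m.
    elim: m => [|m IHm]; first by rewrite mul0r expr0.
    rewrite exprS -natr1; have : 1 <= (1 + y) ^+ m by rewrite exprn_ege1// lerDl.
    by nra.
  apply: (@le_trans _ _ ((1 - y) ^+ m * (1 + y) ^+ m)).
    by rewrite ler_wpM2l// exprn_ge0// subr_ge0.
  by rewrite -exprMn exprn_ile1//; nra.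
case: ltP => [wlt|wge].
- apply: (@squeeze_cvgr _ _ _ _ (fun k => 1 - (2 * w) ^+ k) (fun=> 1)).
  + apply: nearW => k; rewrite exprn_ile1 ?andbT; last 2 first.
      by have := wk k; lra.
      by have := wk k; lra.
    by rewrite exprMn -natrX; exact: bern.
  + rewrite -[X in _ --> X]subr0; apply: cvgB; first exact: cvg_cst.
    by apply: cvg_expr; rewrite ger0_norm; lra.
  + exact: cvg_cst.
- have {}wge : 2^-1 < w by rewrite lt_neqAle eq_sym wn.
  have w2 : 0 < 2 * w by lra.
  apply: (@squeeze_cvgr _ _ _ _ (fun=> 0) (fun k => (2 * w)^-1 ^+ k)).
  + apply: nearW => k; rewrite exprn_ge0/=; last by have := wk k; lra.
    rewrite exprVn -[leRHS]mul1r ler_pdivlMr ?exprn_gt0//.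
    by rewrite exprMn -natrX; exact: bern'.
  + exact: cvg_cst.
  + apply: cvg_expr; rewrite ger0_norm ?invr_ge0; last by lra.
    by rewrite invf_lt1//; lra.
Qed.

Lemma null_multiplier_threshold w : null_multiplier w ->
  {ae mu, forall x, w x != 2^-1} ->
  null_multiplier (fun x => (w x < 2^-1)%R%:R).
Proof.
move=> Mw wn; have [mw w01 _] := Mw.
apply: (@null_multiplier_lim (fun k x => (1 - w x ^+ k) ^+ (2 ^ k)%N)).
- move=> k; apply: null_multiplierX; apply: null_multiplier_onem.
  exact: null_multiplierX.
- rewrite (_ : (fun x => _) = \1_[set x | w x < 2^-1]).
    apply: measurable_indic; rewrite -[X in measurable X]setTI.
    exact: measurable_fun_ltr.
  by apply/funext => x; rewrite indicE mem_setE.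
- by move=> x; case: (_ < _); rewrite ?lexx ?ler01.
- by apply: filterS wn => x wx; exact: cvg_threshold.
Qed.

(** Shifting the phase by [pi / 2] turns the cosine multiplier into [(1 - sin) / 2], which is below
    1/2 exactly where the sine is positive and equals 1/2 only on a null set. *)
Lemma null_multiplier_sin_gt0 xi c : xi != 0 ->
  null_multiplier (fun x => (0 < sin (dot_rV xi x + c))%R%:R).
Proof.
move=> xi0.
have E x : (1 + cos (dot_rV xi x + (c + pi / 2))) / 2 =
    (1 - sin (dot_rV xi x + c)) / 2.
  by rewrite addrA cosDpihalf.
rewrite [X in null_multiplier X](_ : _ =
    (fun x => ((1 + cos (dot_rV xi x + (c + pi / 2))) / 2 < 2^-1)%R%:R)).
  apply: null_multiplier_threshold; first exact: null_multiplier_cos.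
  apply: filterS (ae_sin_dot_rV_neq0 c xi0) => x; rewrite E; apply: contra.
  by move=> /eqP h; apply/eqP; lra.
apply/funext => x; rewrite E; congr ((nat_of_bool _)%:R).
by apply/idP/idP => ?; lra.
Qed.

(** Stretching removes the periodicity: once [(xi . x - a) / (k + 1)] lies in []- pi, pi[], its sine
    has the sign of [xi . x - a]. *)
Lemma null_multiplier_halfspace xi a : xi != 0 ->
  null_multiplier \1_[set x | a < dot_rV xi x].
Proof.
move=> xi0.
apply: (@null_multiplier_lim
  (fun k x => (0 < sin (dot_rV (k.+1%:R^-1 *: xi) x + - (k.+1%:R^-1 * a)))%R%:R)).
- move=> k; apply: null_multiplier_sin_gt0.
  by rewrite scaler_eq0 invr_eq0 pnatr_eq0.
- apply: measurable_indic; rewrite -[X in measurable X]setTI.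
  apply: (measurable_fun_ltr _ (measurable_dot_rV xi)) => //.
- by move=> x; rewrite indicE; case: (_ \in _); rewrite ?lexx ?ler01.
- apply: aeW => x; apply: cvg_near_cst; near=> k.
  rewrite dot_rVZl -mulrBr indicE mem_setE; congr ((nat_of_bool _)%:R).
  set t := dot_rV xi x - a.
  have tk : `|t / k.+1%:R| < pi.
    rewrite normrM normfV [`|k.+1%:R|]ger0_norm// ltr_pdivrMr//.
    rewrite mulrC -ltr_pdivrMr ?pi_gt0//.
    by apply: (@lt_le_trans _ _ k%:R); [near: k; exact: nbhs_infty_gtr|rewrite ler_nat].
  rewrite -[RHS]/(a < dot_rV xi x).
  have -> : (a < dot_rV xi x) = (0 < t / k.+1%:R).
    by rewrite pmulr_lgt0 ?invr_gt0// /t subr_gt0.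
  rewrite mulrC; move: tk; set s := t / _ => sp.
  have [s0|s0|<-] := ltgtP 0 s; last by rewrite sin0 ltxx.
    by rewrite sin_gt0_pi// s0 -(gtr0_norm s0).
  apply/negbTE; rewrite -leNgt -oppr_ge0 -sinN ltW// sin_gt0_pi//.
  by rewrite oppr_gt0 s0 -(ltr0_norm s0).
Unshelve. all: by end_near. Qed.

(** Complements come from [1 - v], finite unions from products by De Morgan, countable unions from
    limits of finite ones. *)
Lemma null_multiplier_sigma_algebra :
  sigma_algebra setT [set A | null_multiplier \1_A].
Proof.
have HC A : null_multiplier \1_A -> null_multiplier \1_(~` A).
  move=> MA; rewrite [X in null_multiplier X](_ : _ = (fun x => 1 - \1_A x)).
    exact: null_multiplier_onem.
  by apply/funext => x; rewrite !indicE in_setC; case: (_ \in _); rewrite ?subr0 ?subrr.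
have HU A B : null_multiplier \1_A -> null_multiplier \1_B ->
    null_multiplier \1_(A `|` B).
  move=> MA MB; rewrite -[A `|` B]setCK setCU; apply: (HC); rewrite indicI.
  by apply: null_multiplierM; exact: HC.
have H0 : null_multiplier \1_set0.
  rewrite -setCT; apply: (HC); rewrite indicT; exact: null_multiplier1.
split => //= [A MA|F MF]; first by rewrite setTD; exact: HC.
have MU k : null_multiplier \1_(\big[setU/set0]_(i < k) F i).
  elim: k => [|k IHk]; first by rewrite big_ord0.
  by rewrite big_ord_recr /=; exact: HU.
apply: (null_multiplier_lim MU).
- apply: measurable_indic; apply: bigcup_measurable => k _.
  by have [/measurable_indicP] := MF k.
- by move=> x; rewrite indicE; case: (_ \in _); rewrite ?lexx ?ler01.
- apply: aeW => x; apply: cvg_near_cst.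
  rewrite /= !indicE; have [xF|xF] := boolP (x \in \bigcup_k F k).
    have [k _ Fkx] := set_mem xF; exists k.+1 => // m /= km.
    by rewrite indicE mem_set// -bigcup_mkord; exists k.
  apply: nearW => m; rewrite indicE memNset// => xFm; move: xF.
  rewrite notin_setE; apply.
  by move: xFm; rewrite -bigcup_mkord => -[k _ Fkx]; exists k.
Qed.

(** The coordinate preimages of intervals []a, b]] generate the sigma-algebra, and each is a
    difference of two half-spaces. *)
Lemma null_multiplier_measurable (A : set 'rV[R]_n) :
  measurable A -> null_multiplier \1_A.
Proof.
have [H0 HC HU] := null_multiplier_sigma_algebra.
suff H : g_sigma_preimage (@coord_rV R n) `<=` [set A | null_multiplier \1_A].
  by move=> mA; exact: H.
apply: smallest_sub; first exact: null_multiplier_sigma_algebra.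
rewrite -bigcup_seq => _ [i _] [B mB <-] /=; rewrite setTI.
suff : @measurable _ (measurableTypeR R) `<=`
  [set B | null_multiplier \1_(coord_rV i @^-1` B)] by exact.
apply: smallest_sub.
  split=> [|C MC|F MF] /=; first by rewrite preimage_set0.
    by rewrite setTD preimage_setC -setTD; exact: HC.
  by rewrite preimage_bigcup; exact: HU.
move=> _ [[a b] _ <-] /=.
have dE c : [set x | c < dot_rV (delta_mx ord0 i) x] = coord_rV i @^-1` `]c, +oo[%classic.
  by apply/seteqP; split=> x /=; rewrite dot_rV_delta in_itv/= andbT.
have d0 : delta_mx ord0 i != 0 :> 'rV[R]_n.
  by apply/eqP => /matrixP/(_ ord0 i)/eqP; rewrite !mxE !eqxx oner_eq0.
rewrite (_ : _ @^-1` _ = [set x | a < dot_rV (delta_mx ord0 i) x] `&`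
   (setT `\` [set x | b < dot_rV (delta_mx ord0 i) x])).
  rewrite indicI; apply: null_multiplierM; first exact: null_multiplier_halfspace.
  by apply: (HC); exact: null_multiplier_halfspace.
apply/seteqP; split=> x; rewrite /= in_itv /= !dot_rV_delta leNgt.
  by move=> /andP[? /negP].
by move=> [-> [_ /negP]].
Qed.

Lemma fourier_null_ae0 h : mu.-integrable setT (EFin \o h) ->
  fourier_null h -> {ae mu, forall x, h x = 0}.
Proof.
move=> ih h0.
have : ae_eq mu setT (EFin \o h) (cst 0%E).
  apply: integral_ae_eq => // A _ mA; rewrite integral_cst// mul0e.
  (* At frequency 0 and phase 0 the cosine is 1, so the vanishing integral is that of [h] over
     [A]. *)
  have [_ _ /(_ h ih h0 0 0)] := null_multiplier_measurable mA.
  rewrite /Rintegral => HA.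
  rewrite integral_mkcond -[RHS]/(0%:E) -HA fineK.
    apply: eq_integral => x _; rewrite patchE/= /dot_rV big1.
      by rewrite addr0 cos0 mulr1 indicE; case: (x \in A); rewrite ?mulr1 ?mulr0.
    by move=> i _; rewrite mxE mul0r.
  apply: integrable_fin_num => //; apply: integrable_cos.
  by apply: integrable_mult => //; exact: null_multiplier_measurable.
by apply: filterS => x /(_ I)[].
Qed.

End injectivity.

(** * Fourier transform and convolution *)

Section convolution.
Context {R : realType} (n : nat).
Local Notation mu := (@lebesgue_rV R n).
Implicit Types (f g h : 'rV[R]_n -> R) (xi x y : 'rV[R]_n).

Let rVn : measurableType _ := 'rV[R]_n.

Lemma measurable_subB_rV :
  measurable_fun [set: rVn * rVn] (fun p => p.1 - p.2 : rVn).
Proof.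
apply/measurable_rVP => i.
apply: (eq_measurable_fun (fun p : rVn * rVn => coord_rV i p.1 - coord_rV i p.2)).
  by move=> p _; rewrite /coord_rV /= !mxE.
by apply: measurable_funB; apply: (measurableT_comp (measurable_coord_rV i)).
Qed.

Section bilinear.
Variables f g : 'rV[R]_n -> R.
Hypotheses (if_ : mu.-integrable setT (EFin \o f))
           (ig : mu.-integrable setT (EFin \o g)).

Let mf : measurable_fun setT f.
Proof. by apply/measurable_EFinP; exact: measurable_int if_. Qed.

Let mg : measurable_fun setT g.
Proof. by apply/measurable_EFinP; exact: measurable_int ig. Qed.

Let k (p : rVn * rVn) := f (p.1 - p.2) * g p.2.

Let mk : measurable_fun setT k.
Proof.
apply: measurable_funM; first exact: (measurableT_comp mf measurable_subB_rV).
exact: (measurableT_comp mg).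
Qed.

(** Tonelli: by translation invariance the inner integral of the absolute value is [|g y|] times the
    mass of [|f|]. *)
Lemma integrable_convolution_kernel :
  (mu \x mu)%E.-integrable [set: rVn * rVn] (EFin \o k).
Proof.
apply/integrable21ltyP; first exact/measurable_EFinP.
have /integrableP[_ foo] := if_; have /integrableP[_ goo] := ig.
have E y : (\int[mu]_x `|(EFin \o k) (x, y)| =
    `|(g y)%:E| * \int[mu]_x `|(EFin \o f) x|)%E.
  rewrite -(ge0_integral_translate y (F := fun x => `|(f x)%:E|%E))//; last first.
    by apply: measurableT_comp => //; exact/measurable_EFinP.
  rewrite -ge0_integralZl//.
    by apply: eq_integral => x _; rewrite /k /= normrM mulrC EFinM.
  apply: (measurableT_comp (f := fun x => `|(f x)%:E|%E) _ (measurable_subr_rV y)).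
  by apply: measurableT_comp => //; exact/measurable_EFinP.
under eq_integral do rewrite E.
rewrite ge0_integralZr//; last exact: integral_ge0.
  by rewrite lte_mul_pinfty// ?integral_ge0// ge0_fin_numE// integral_ge0.
by apply: measurableT_comp => //; exact/measurable_EFinP.
Qed.

Lemma measurable_convolution : measurable_fun setT (convolution f g).
Proof.
apply: (measurableT_comp (f := @fine R)) => //.
exact: (measurable_fubini_F integrable_convolution_kernel).
Qed.

Lemma integrable_convolution : mu.-integrable setT (EFin \o convolution f g).
Proof.
apply: le_integrable (integrable_fubini_F integrable_convolution_kernel) => //.
  by apply/measurable_EFinP; exact: measurable_convolution.
(* Where the inner integral is infinite [fine] returns 0, so the domination holds at every point. *)
move=> x _; rewrite /= /convolution /Rintegral /fubini_F /=.
by set I := (\int[_]_y _)%E; case: I => //= *; rewrite ?normr0 ?leey.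
Qed.

(** Fubini followed by the substitution [z = x - y]. With [phi] a cosine or a sine this yields the
    transforms of a convolution. *)
Lemma Rintegral_convolutionM (phi : 'rV[R]_n -> R) :
  measurable_fun setT phi -> (forall x, `|phi x| <= 1) ->
  \int[mu]_x (convolution f g x * phi x) =
  \int[mu]_y (g y * \int[mu]_z (f z * phi (z + y))).
Proof.
move=> mphi phi1; pose kp (p : rVn * rVn) := k p * phi p.1.
have ikp : (mu \x mu)%E.-integrable [set: rVn * rVn] (EFin \o kp).
  apply: (integrable_mulr_bounded (v := phi \o fst) (M := 1)) => //.
    exact: integrable_convolution_kernel.
  - exact: measurableT_comp.
  - by move=> x; exact: phi1.
congr fine.
transitivity (\int[mu]_x \int[mu]_y (EFin \o kp) (x, y))%E.
  apply: ae_eq_integral => //.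
  - apply/measurable_EFinP/measurable_funM => //; exact: measurable_convolution.
  - exact: (measurable_fubini_F ikp).
  (* The slice of the kernel is integrable only for almost every [x], so [phi x] enters the inner
     integral only almost everywhere. *)
  - apply: filterS (ae_integrable1 integrable_convolution_kernel) => x ikx _.
    rewrite -RintegralZr// fineK//.
    exact: (integrable_fin_num measurableT (integrableZr measurableT (phi x) ikx)).
rewrite (Fubini ikp); apply: eq_integral => y _.
have mphiy : measurable_fun setT (fun z : 'rV[R]_n => phi (z + y)).
  rewrite (_ : (fun z => _) = phi \o (fun z : 'rV[R]_n => z - (- y))).
    exact: (measurableT_comp mphi (measurable_subr_rV _)).
  by apply/funext => z /=; rewrite opprK.
have iz : mu.-integrable setT (EFin \o (fun z => f z * phi (z + y))).
  exact: (integrable_mulr_bounded if_ mphiy).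
rewrite -RintegralZl// fineK; last first.
  exact: (integrable_fin_num measurableT (integrableZl measurableT (g y) iz)).
rewrite -(integral_translate y (F := fun z => (g y * (f z * phi (z + y)))%:E)).
  by apply: eq_integral => x _; rewrite /kp /k /= subrK mulrCA mulrA.
apply/measurable_EFinP/measurable_funM => //.
by apply/measurable_funM.
Qed.

End bilinear.

End convolution.

(** * Cosine and sine transforms *)

Section fourier.
Context {R : realType} (n : nat).
Local Notation mu := (@lebesgue_rV R n).
Implicit Types (f g h : 'rV[R]_n -> R) (xi x y : 'rV[R]_n).

(** Real and imaginary parts of [f^ (xi) = int f(x) exp (i xi . x)]. *)
Definition fourier_cos f xi := \int[mu]_x (f x * cos (dot_rV xi x)).
Definition fourier_sin f xi := \int[mu]_x (f x * sin (dot_rV xi x)).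

Lemma measurable_cos_dot xi : measurable_fun setT (fun x => cos (dot_rV xi x)).
Proof.
apply: (measurableT_comp _ (measurable_dot_rV xi)).
by apply: continuous_measurable_fun; exact: continuous_cos.
Qed.

Lemma measurable_sin_dot xi : measurable_fun setT (fun x => sin (dot_rV xi x)).
Proof.
apply: (measurableT_comp _ (measurable_dot_rV xi)).
by apply: continuous_measurable_fun; exact: continuous_sin.
Qed.

Lemma integrable_cos_dot f xi : mu.-integrable setT (EFin \o f) ->
  mu.-integrable setT (EFin \o (fun x => f x * cos (dot_rV xi x))).
Proof.
move=> ih; apply: (integrable_mulr_bounded ih (measurable_cos_dot xi)) => x.
exact: cos_max.
Qed.

Lemma integrable_sin_dot f xi : mu.-integrable setT (EFin \o f) ->
  mu.-integrable setT (EFin \o (fun x => f x * sin (dot_rV xi x))).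
Proof.
move=> ih; apply: (integrable_mulr_bounded ih (measurable_sin_dot xi)) => x.
exact: sin_max.
Qed.

Lemma fourier_phase f xi c : mu.-integrable setT (EFin \o f) ->
  \int[mu]_x (f x * cos (dot_rV xi x + c)) =
  cos c * fourier_cos f xi - sin c * fourier_sin f xi.
Proof.
move=> if_; rewrite -!RintegralZl ?integrable_cos_dot ?integrable_sin_dot//.
rewrite -RintegralB//.
- by apply: eq_Rintegral => x _; rewrite cosD; ring.
- exact: (integrableZl measurableT (cos c) (integrable_cos_dot xi if_)).
- exact: (integrableZl measurableT (sin c) (integrable_sin_dot xi if_)).
Qed.

Lemma fourier_phase_sin f xi c : mu.-integrable setT (EFin \o f) ->
  \int[mu]_x (f x * sin (dot_rV xi x + c)) =
  sin c * fourier_cos f xi + cos c * fourier_sin f xi.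
Proof.
move=> if_; rewrite -!RintegralZl ?integrable_cos_dot ?integrable_sin_dot//.
rewrite -RintegralD//.
- by apply: eq_Rintegral => x _; rewrite sinD; ring.
- exact: (integrableZl measurableT (sin c) (integrable_cos_dot xi if_)).
- exact: (integrableZl measurableT (cos c) (integrable_sin_dot xi if_)).
Qed.

(** Together with the sine formula below, this is [f^ g^] split into real and imaginary parts. *)
Lemma fourier_cos_convolution f g xi :
  mu.-integrable setT (EFin \o f) -> mu.-integrable setT (EFin \o g) ->
  fourier_cos (convolution f g) xi =
  fourier_cos f xi * fourier_cos g xi - fourier_sin f xi * fourier_sin g xi.
Proof.
move=> if_ ig; rewrite [LHS](Rintegral_convolutionM if_ ig)//; last 2 first.
- exact: measurable_cos_dot.
- by move=> x; exact: cos_max.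
under eq_Rintegral => y _.
  under eq_Rintegral do rewrite dot_rVDr.
  rewrite fourier_phase// mulrBr 2!mulrA; over.
rewrite RintegralB ?RintegralZr//;
  try exact: integrable_cos_dot; try exact: integrable_sin_dot.
- by rewrite -/(fourier_cos g xi) -/(fourier_sin g xi); ring.
- exact: (integrableZr measurableT (fourier_cos f xi) (integrable_cos_dot xi ig)).
- exact: (integrableZr measurableT (fourier_sin f xi) (integrable_sin_dot xi ig)).
Qed.

Lemma fourier_sin_convolution f g xi :
  mu.-integrable setT (EFin \o f) -> mu.-integrable setT (EFin \o g) ->
  fourier_sin (convolution f g) xi =
  fourier_cos f xi * fourier_sin g xi + fourier_sin f xi * fourier_cos g xi.
Proof.
move=> if_ ig; rewrite [LHS](Rintegral_convolutionM if_ ig)//; last 2 first.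
- exact: measurable_sin_dot.
- by move=> x; exact: sin_max.
under eq_Rintegral => y _.
  under eq_Rintegral do rewrite dot_rVDr.
  rewrite fourier_phase_sin// mulrDr 2!mulrA; over.
rewrite RintegralD ?RintegralZr//;
  try exact: integrable_cos_dot; try exact: integrable_sin_dot.
- by rewrite -/(fourier_cos g xi) -/(fourier_sin g xi); ring.
- exact: (integrableZr measurableT (fourier_cos f xi) (integrable_sin_dot xi ig)).
- exact: (integrableZr measurableT (fourier_sin f xi) (integrable_cos_dot xi ig)).
Qed.

Lemma fourier_injective f g :
  mu.-integrable setT (EFin \o f) -> mu.-integrable setT (EFin \o g) ->
  fourier_cos f =1 fourier_cos g -> fourier_sin f =1 fourier_sin g ->
  {ae mu, forall x, f x = g x}.
Proof.
move=> if_ ig Cfg Sfg.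
have ifg : mu.-integrable setT (EFin \o (fun x => f x - g x)).
  exact: (integrableB measurableT if_ ig).
have : {ae mu, forall x, f x - g x = 0}.
  apply: (fourier_null_ae0 ifg) => xi c; rewrite fourier_phase//.
  rewrite /fourier_cos /fourier_sin.
  under eq_Rintegral do rewrite mulrBl.
  under [X in _ - _ * X]eq_Rintegral do rewrite mulrBl.
  rewrite !RintegralB//; try exact: integrable_cos_dot; try exact: integrable_sin_dot.
  by rewrite -!/(fourier_cos _ _) -!/(fourier_sin _ _) Cfg Sfg !subrr !mulr0 subrr.
by apply: filterS => x /eqP; rewrite subr_eq0 => /eqP.
Qed.

End fourier.

(** * A nonnegative solution of the convolution equation *)

Section nonneg_solution.
Context {R : realType} (n : nat).
Local Notation mu := (@lebesgue_rV R n).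
Local Open Scope ereal_scope.
Implicit Types (F G : 'rV[R]_n -> \bar R).

Let rVn : measurableType _ := 'rV[R]_n.

(** Convolution with values in the extended reals, so that the iteration and its limit make sense
    before any integrability is known. *)
Let econv F G (x : 'rV[R]_n) := \int[mu]_y (F (x - y)%R * G y).

Let measurable_kernel F G : measurable_fun setT F -> measurable_fun setT G ->
  measurable_fun [set: rVn * rVn] (fun p => F (p.1 - p.2)%R * G p.2).
Proof.
move=> mF mG; apply: emeasurable_funM.
  exact: (measurableT_comp mF (@measurable_subB_rV R n)).
exact: (measurableT_comp mG).
Qed.

Let measurable_econv F G : measurable_fun setT F -> measurable_fun setT G ->
  (forall x, 0 <= F x) -> (forall x, 0 <= G x) -> measurable_fun setT (econv F G).
Proof.
move=> mF mG F0 G0.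
apply: (measurable_fun_fubini_tonelli_F (fun p : rVn * rVn => F (p.1 - p.2)%R * G p.2)).
  exact: measurable_kernel.
by move=> p; exact: mule_ge0.
Qed.

Let integral_econv F G : measurable_fun setT F -> measurable_fun setT G ->
  (forall x, 0 <= F x) -> (forall x, 0 <= G x) ->
  \int[mu]_x econv F G x = (\int[mu]_x F x) * (\int[mu]_x G x).
Proof.
move=> mF mG F0 G0.
rewrite (fubini_tonelli (m1 := mu) (m2 := mu)
  (fun p : rVn * rVn => F (p.1 - p.2)%R * G p.2))/=; last 2 first.
- exact: measurable_kernel.
- by move=> p; exact: mule_ge0.
rewrite -ge0_integralZl//; last exact: integral_ge0.
apply: eq_integral => y _; rewrite ge0_integralZr ?ge0_integral_translate//.
exact: (measurableT_comp mF (measurable_subr_rV y)).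
Qed.

Let econv_ge0 F G : (forall x, 0 <= F x) -> (forall x, 0 <= G x) ->
  forall x, 0 <= econv F G x.
Proof. by move=> F0 G0 x; apply: integral_ge0 => y _; exact: mule_ge0. Qed.

Let measurable_slice F G (x : 'rV[R]_n) : measurable_fun setT F -> measurable_fun setT G ->
  measurable_fun setT (fun y : 'rV[R]_n => F (x - y)%R * G y).
Proof.
move=> mF mG; apply: emeasurable_funM => //.
exact: (measurableT_comp mF (measurable_subl_rV x)).
Qed.

Variable u : 'rV[R]_n -> R.
Hypotheses (mu_ : measurable_fun setT u) (u0 : forall x, (0 <= u x)%R)
  (iu : \int[mu]_x (u x)%:E <= (4^-1)%:E).

Let g_ := fix g_ k := match k with
  | 0 => fun=> 0
  | j.+1 => fun x => (u x)%:E + econv (g_ j) (g_ j) x end.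

Let g_P k : measurable_fun setT (g_ k) /\ forall x, 0 <= g_ k x.
Proof.
elim: k => [|k [mgk gk0]] /=; first by split=> //; exact: measurable_cst.
split=> [|x]; last by rewrite adde_ge0 ?lee_fin ?econv_ge0.
by apply: emeasurable_funD; [exact/measurable_EFinP|exact: measurable_econv].
Qed.

Let g_S k x : g_ k.+1 x = (u x)%:E + econv (g_ k) (g_ k) x. Proof. by []. Qed.

Let mg_ k : measurable_fun setT (g_ k). Proof. exact: (g_P k).1. Qed.
Let g_0 k x : 0 <= g_ k x. Proof. exact: (g_P k).2. Qed.

Let g_nd x : nondecreasing_seq (g_ ^~ x).
Proof.
apply/nondecreasing_seqP => k; elim: k x => [|k IHk] x; first exact: g_0.
rewrite !g_S leeD2l//; apply: ge0_le_integral => //.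
- by move=> y _; exact: mule_ge0.
- exact: (measurable_slice x (mg_ k) (mg_ k)).
- exact: (measurable_slice x (mg_ k.+1) (mg_ k.+1)).
- by move=> y _; exact: lee_pmul.
Qed.

Let integral_g_ k : \int[mu]_x g_ k x <= (2^-1)%:E.
Proof.
elim: k => [|k IHk]; first by rewrite integral0 lee_fin.
rewrite /= ge0_integralD//; last 3 first.
- exact/measurable_EFinP.
- by move=> x _; exact: econv_ge0.
- exact: measurable_econv.
rewrite integral_econv//.
apply: (@le_trans _ _ ((4^-1)%:E + (2^-1)%:E * (2^-1)%:E)).
  by rewrite leeD// lee_pmul// integral_ge0.
  by rewrite -EFinM -EFinD lee_fin; lra.
by move=> x _; rewrite lee_fin.
Qed.

Let g x := limn (g_ ^~ x).

Let g_cvg x : g_ ^~ x @ \oo --> g x.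
Proof. by apply: ereal_nondecreasing_is_cvgn; exact: g_nd. Qed.

Let g_le k x : g_ k x <= g x.
Proof.
apply: lime_ge; first exact: g_cvg.
by exists k => // m /= km; exact: g_nd.
Qed.

Let g0 x : 0 <= g x. Proof. exact: le_trans (g_0 0 x) (g_le 0 x). Qed.

Let mg : measurable_fun setT g.
Proof. by apply: emeasurable_fun_cvg mg_ _ => x _; exact: g_cvg. Qed.

Let g_eq0 x : g x = 0 -> forall k, g_ k x = 0.
Proof.
by move=> gx k; apply/eqP; rewrite eq_le g_0 andbT -gx; exact: g_le.
Qed.

Let g_cvgM x y : g_ k x * g_ k y @[k --> \oo] --> g x * g y.
Proof.
(* If a limit is 0, its nonnegative nondecreasing sequence is identically 0; this disposes of the
   indeterminate product [0 * +oo]. *)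
have [gx0|gx0] := eqVneq (g x) 0.
  rewrite gx0 mul0e (_ : (fun _ => _) = cst 0); first exact: cvg_cst.
  by apply/funext => k; rewrite (g_eq0 gx0) mul0e.
have [gy0|gy0] := eqVneq (g y) 0.
  rewrite gy0 mule0 (_ : (fun _ => _) = cst 0); first exact: cvg_cst.
  by apply/funext => k; rewrite (g_eq0 gy0) mule0.
apply: cvgeM; [|exact: g_cvg|exact: g_cvg].
by move: gx0 gy0; rewrite /mule_def; case: (g x) => [a| |]; case: (g y) => [b| |].
Qed.

(** Monotone convergence carries the recursion to the limit at every point, infinite values
    included. *)
Let gE x : g x = (u x)%:E + econv g g x.
Proof.
have h : g_ k.+1 x @[k --> \oo] --> (u x)%:E + econv g g x.
  apply: cvgeD; [by rewrite ?fin_num_adde_defr|exact: cvg_cst|].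
  have H := @cvg_monotone_convergence _ _ _ mu setT measurableT
    (fun k y => g_ k (x - y)%R * g_ k y) (fun k => measurable_slice x (mg_ k) (mg_ k))
    (fun k y _ => mule_ge0 (g_0 k _) (g_0 k _)) _.
  rewrite /econv (_ : \int[mu]_y _ =
    \int[mu]_y limn (fun k => g_ k (x - y)%R * g_ k y)).
    by apply: H => y _ j k jk; apply: lee_pmul => //; exact: g_nd.
  by apply: eq_integral => y _; apply/esym/cvg_lim => //; exact: g_cvgM.
have h' : g_ k.+1 x @[k --> \oo] --> g x.
  by move: (@g_cvg x); rewrite -(cvg_shiftS (g_ ^~ x)).
by rewrite -(cvg_lim _ h)// (cvg_lim _ h').
Qed.

Let integral_g : \int[mu]_x g x <= (2^-1)%:E.
Proof.
rewrite /g monotone_convergence//.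
apply: lime_le; last by apply: nearW => k; exact: integral_g_.
apply: ereal_nondecreasing_is_cvgn => j k jk; apply: ge0_le_integral => //.
by move=> x _; exact: g_nd.
Qed.

(* The monotone iteration [g := u + g * g] started from 0 stays below mass 1/2
   because 1/4 + (1/2)^2 = 1/2. *)
Lemma exists_nonneg_solution : exists G : 'rV[R]_n -> R,
  [/\ forall x, (0 <= G x)%R, mu.-integrable setT (EFin \o G),
      (\int[mu]_x G x <= 2^-1)%R &
      {ae mu, forall x, (G x = u x + convolution G G x)%R}].
Proof.
have ig : mu.-integrable setT g.
  apply/integrableP; split=> //; under eq_integral do rewrite gee0_abs//.
  exact: le_lt_trans integral_g (ltry _).
have gfin : {ae mu, forall x, g x \is a fin_num}.
  by apply: filterS (integrable_ae measurableT ig) => x /(_ I).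
pose G x := fine (g x).
have mG : measurable_fun setT G by exact: measurableT_comp.
have gG : ae_eq mu setT g (EFin \o G).
  by apply: filterS (gfin) => x gx _; rewrite /= fineK.
exists G; split.
- by move=> x; exact: fine_ge0.
- apply: (le_integrable measurableT _ _ ig); first exact/measurable_EFinP.
  by move=> x _ /=; rewrite /G; case: (g x) => [r| |]//=; rewrite ?leey// normr0 leey.
- have E : \int[mu]_x (G x)%:E = \int[mu]_x g x.
    by apply/esym/ae_eq_integral => //; exact/measurable_EFinP.
  rewrite /Rintegral E -lee_fin fineK//.
  by rewrite ge0_fin_numE ?integral_ge0// (le_lt_trans integral_g)// ltry.
- apply: filterS (gfin) => x gx.
  have E : econv g g x = \int[mu]_y (G (x - y) * G y)%:E.
    apply: ae_eq_integral => //; first exact: measurable_slice.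
      under eq_fun do rewrite EFinM.
      by apply: (@measurable_slice (EFin \o G) (EFin \o G)); exact/measurable_EFinP.
    (* For fixed [x], finiteness of [g (x - y)] for almost every [y] follows from the reflection
       invariance of null sets. *)
    have gfx : {ae mu, forall y, g (x - y)%R \is a fin_num}.
      exact: (negligible_reflect x gfin).
    apply: filterS2 (gfin) gfx => y gy gxy _.
    by rewrite /G EFinM !fineK.
  rewrite {1}/G gE fineD ?E//.
  by move: gx; rewrite gE fin_numD E => /andP[].
Qed.

End nonneg_solution.

(** * Uniqueness of the solution *)

Section continuity.
Context d (T : measurableType d) {R : realType}.
Variable mu : {measure set T -> \bar R}.

Lemma continuous_Rintegral_comp (s : R -> R) (h theta : T -> R) :
  continuous s -> (forall r, `|s r| <= 1) ->
  mu.-integrable setT (EFin \o h) -> measurable_fun setT theta ->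
  continuous (fun t : R => \int[mu]_x (h x * s (t * theta x))).
Proof.
move=> cs s1 ih mtheta r.
have ms : measurable_fun setT s by exact: continuous_measurable_fun.
have rI : r \in `](r - 1), (r + 1)[%classic.
  by rewrite inE /= in_itv /=; lra.
apply: (@continuity_under_integral _ _ _ mu (fun (t : R) x => h x * s (t * theta x))
  setT measurableT (r - 1) (r + 1) _ _ (fun x => `|h x|) _ _ r rI).
- move=> x _; apply: (integrable_mulr_bounded (M := 1) ih) => //.
  by apply: (measurableT_comp ms); apply: measurable_funM.
- apply: aeW => y _ x _ /=; apply: cvgM; first exact: cvg_cst.
  apply: continuous_comp; last exact: cs.
  by apply: cvgM; [exact: cvg_id|exact: cvg_cst].
- exact: (integrable_abse ih).
- by move=> x _; apply: aeW => y _; rewrite normrM ler_piMr.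
Qed.

End continuity.

Section branch.
Context {R : realType}.

(* If [F ^ 2 = T ^ 2] for the complex functions [F = F1 + i F2] and
   [T = T1 + i T2], with [T] nonvanishing on the half-line, then [Re (F T^* )] is
   [+- |T| ^ 2] and its sign is constant. *)
Lemma square_root_branch (F1 F2 T1 T2 : R -> R) :
  continuous F1 -> continuous F2 -> continuous T1 -> continuous T2 ->
  (forall r, 0 < r -> F1 r ^+ 2 - F2 r ^+ 2 = T1 r ^+ 2 - T2 r ^+ 2) ->
  (forall r, 0 < r -> F1 r * F2 r = T1 r * T2 r) ->
  (forall r, 0 < r -> (T1 r != 0) || (T2 r != 0)) ->
  (forall r, 0 < r -> F1 r = T1 r /\ F2 r = T2 r) \/
  (forall r, 0 < r -> F1 r = - T1 r /\ F2 r = - T2 r).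
Proof.
move=> cF1 cF2 cT1 cT2 re im T0.
pose D r := F1 r * T1 r + F2 r * T2 r.
have cD : continuous D.
  move=> r; apply: cvgD; apply: cvgM.
  - exact: cF1.
  - exact: cT1.
  - exact: cF2.
  - exact: cT2.
have PM r : 0 < r -> (F1 r = T1 r /\ F2 r = T2 r) \/ (F1 r = - T1 r /\ F2 r = - T2 r).
  move=> r0; have := re _ r0; have := im _ r0.
  move: (F1 r) (F2 r) (T1 r) (T2 r) => a b x y h1 h2.
  (* For complex numbers, [|F - T| ^ 2 |F + T| ^ 2 = |F ^ 2 - T ^ 2| ^ 2], written in
     coordinates. *)
  have : ((a - x) ^+ 2 + (b - y) ^+ 2) * ((a + x) ^+ 2 + (b + y) ^+ 2) == 0.
    rewrite [X in X == 0](_ : _ =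
      ((a ^+ 2 - b ^+ 2) - (x ^+ 2 - y ^+ 2)) ^+ 2 + 4 * (a * b - x * y) ^+ 2); last by ring.
    by rewrite h1 h2 !subrr expr0n mulr0 addr0.
  rewrite mulf_eq0 !paddr_eq0 ?sqr_ge0// !sqrf_eq0 !subr_eq0 !addr_eq0.
  by case/orP => /andP[/eqP -> /eqP ->]; [left|right].
have N r : 0 < r -> 0 < T1 r ^+ 2 + T2 r ^+ 2.
  move=> /T0 /orP[] t0; first by rewrite ltr_pwDl ?sqr_ge0// exprn_even_gt0.
  by rewrite ltr_pwDr ?sqr_ge0// exprn_even_gt0.
have Dpos r : 0 < r -> 0 < D r -> F1 r = T1 r /\ F2 r = T2 r.
  move=> r0; have [//|[e1 e2]] := PM _ r0; have := N _ r0.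
  by rewrite /D e1 e2; nra.
have Dneg r : 0 < r -> D r < 0 -> F1 r = - T1 r /\ F2 r = - T2 r.
  move=> r0; have [[e1 e2]|//] := PM _ r0; have := N _ r0.
  by rewrite /D e1 e2; nra.
have D0 r : 0 < r -> D r != 0.
  move=> r0; have := N _ r0; apply: contraTneq => Dr0; rewrite -leNgt.
  by move: Dr0; rewrite /D; have [[-> ->]|[-> ->]] := PM _ r0; nra.
(* A change of sign would produce a zero of [D] by the intermediate value theorem. *)
have Dsgn a b : 0 < a -> a <= b -> 0 < D a * D b.
  move=> a0 ab; rewrite ltNge; apply/negP => DD.
  have [||c cab Dc] := @IVT R D a b 0 ab.
  - exact: continuous_subspaceT.
  - rewrite ge_min le_max.
    by case: (leP (D a) 0) => ? /=; case: (leP (D b) 0) => ? /=; nra.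
  have := D0 c; rewrite Dc eqxx => /(_ _)/negP; apply => //.
  by move: cab; rewrite in_itv /= => /andP[ac _]; exact: lt_le_trans ac.
have D1 r : 0 < r -> 0 < D 1 * D r.
  move=> r0; have [r1|/ltW r1] := leP r 1; first by rewrite mulrC; exact: Dsgn.
  exact: Dsgn.
have := D0 1 ltr01; rewrite neq_lt => /orP[] d1; [right|left] => r r0.
  by apply: Dneg => //; have := D1 _ r0; rewrite nmulr_rgt0.
by apply: Dpos => //; have := D1 _ r0; rewrite pmulr_rgt0.
Qed.

End branch.

(** * Elementary trigonometric inequalities *)

Section trigonometric_bounds.
Context {R : realType}.
Implicit Types t : R.

Lemma norm_sin_le t : `|sin t| <= `|t|.
Proof.
have H (a : R) : 0 <= a -> `|sin a| <= a.
  move=> a0; have [|c _] := @MVT_segment R sin cos 0 a a0.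
  - exact: continuous_subspaceT (@continuous_sin R).
  - rewrite sin0 !subr0 => ->; rewrite normrM (ger0_norm a0) ler_piMl//.
    exact: cos_max.
case: (ger0P t) => t0; first exact: H.
by rewrite -normrN -sinN H// oppr_ge0 ltW.
Qed.

Lemma onem_cosE t : 1 - cos t = 2 * sin (t / 2) ^+ 2.
Proof.
have {1}-> : t = (t / 2) *+ 2 by rewrite -mulr_natr divfK ?pnatr_eq0.
by rewrite cos_mulr2n cos2sin2; ring.
Qed.

Lemma onem_cos_ge0 t : 0 <= 1 - cos t.
Proof. by rewrite subr_ge0 cos_le1. Qed.

Lemma onem_cos_le_sqr t : 1 - cos t <= t ^+ 2.
Proof.
rewrite onem_cosE.
have : sin (t / 2) ^+ 2 <= (t / 2) ^+ 2.
  rewrite -[leLHS]real_normK ?num_real// -[leRHS]real_normK ?num_real//.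
  by rewrite lerXn2r ?nnegrE// norm_sin_le.
have := sqr_ge0 t; rewrite expr_div_n; lra.
Qed.

Lemma onem_cos_le_norm t : 1 - cos t <= `|t|.
Proof.
rewrite onem_cosE -real_normK ?num_real//.
have := norm_sin_le (t / 2); have := sin_max (t / 2).
rewrite normrM normfV [`|2|]ger0_norm//.
have := normr_ge0 (sin (t / 2)); move: `|sin _| `|t| => a b; nra.
Qed.

(** By the mean value theorem [sin a - a = (cos c - 1) a] with [0 < c < a], and [1 - cos c <= c]. *)
Lemma norm_sinB_le_sqr t : `|sin t - t| <= t ^+ 2.
Proof.
have H (a : R) : 0 <= a -> `|sin a - a| <= a ^+ 2.
  move=> a0.
  have [|c] := @MVT_segment R (fun x => sin x - x) (fun x => cos x - 1) 0 a a0.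
  - apply: continuous_subspaceT => x; apply: cvgB; first exact: continuous_sin.
    exact: cvg_id.
  - rewrite in_itv /= => /andP[c0 ca]; rewrite sin0 !subr0 => ->.
    rewrite normrM (ger0_norm a0) expr2 ler_wpM2r// distrC.
    rewrite ger0_norm ?onem_cos_ge0// (le_trans (onem_cos_le_norm c))//.
    by rewrite ger0_norm.
case: (lerP 0 t) => t0; first exact: H.
by have := H (- t); rewrite sinN opprK sqrrN addrC distrC oppr_ge0; apply; exact: ltW.
Qed.

Lemma onem_cos1_gt0 : 0 < 1 - cos 1 :> R.
Proof.
rewrite subr_gt0 -[ltRHS]cos0 ltr_cos// in_itv /= ?lexx ?pi_ge0//.
by rewrite ler01 (le_trans _ (pi_ge2 R))// ler1n.
Qed.

(** The cosine decreases on [[0, pi]], which contains [[1, 2]]. *)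
Lemma onem_cos_ge t : 1 <= `|t| <= 2 -> 1 - cos 1 <= 1 - cos t.
Proof.
move=> /andP[t1 t2]; rewrite -(cos_norm t) lerD2l lerN2.
have tI : `|t| \in `[0, pi].
  by rewrite in_itv /= normr_ge0 (le_trans t2)// pi_ge2.
have oI : 1 \in `[0, pi :> R].
  by rewrite in_itv /= ler01 (le_trans _ (pi_ge2 R))// ler1n.
have [<-//|n1] := eqVneq 1 `|t|.
by rewrite ltW// ltr_cos// lt_neqAle n1.
Qed.

End trigonometric_bounds.

(** * The convolution equation on the Fourier side *)

Section convolution_equation.
Context {R : realType} (n : nat).
Local Notation mu := (@lebesgue_rV R n).
Implicit Types (f g u : 'rV[R]_n -> R) (xi x : 'rV[R]_n).

Lemma fourier_cosD f g xi :
  mu.-integrable setT (EFin \o f) -> mu.-integrable setT (EFin \o g) ->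
  fourier_cos (fun x => f x + g x) xi = fourier_cos f xi + fourier_cos g xi.
Proof.
move=> if_ ig; rewrite -RintegralD//; try exact: integrable_cos_dot.
by apply: eq_Rintegral => x _; rewrite mulrDl.
Qed.

Lemma fourier_sinD f g xi :
  mu.-integrable setT (EFin \o f) -> mu.-integrable setT (EFin \o g) ->
  fourier_sin (fun x => f x + g x) xi = fourier_sin f xi + fourier_sin g xi.
Proof.
move=> if_ ig; rewrite -RintegralD//; try exact: integrable_sin_dot.
by apply: eq_Rintegral => x _; rewrite mulrDl.
Qed.

Lemma fourier_cos0 f : fourier_cos f 0 = \int[mu]_x f x.
Proof.
apply: eq_Rintegral => x _; rewrite /dot_rV big1 ?cos0 ?mulr1// => i _.
by rewrite mxE mul0r.
Qed.

Lemma fourier_sin0 f : fourier_sin f 0 = 0.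
Proof.
rewrite /fourier_sin /Rintegral integral0_eq// => x _.
by rewrite /dot_rV big1 ?sin0 ?mulr0// => i _; rewrite mxE mul0r.
Qed.

Lemma fourier_ae_eq f g xi :
  measurable_fun setT f -> measurable_fun setT g ->
  {ae mu, forall x, f x = g x} ->
  fourier_cos f xi = fourier_cos g xi /\ fourier_sin f xi = fourier_sin g xi.
Proof.
move=> mf mg fg; split; apply: ae_eq_Rintegral.
- by apply: measurable_funM => //; exact: measurable_cos_dot.
- by apply: measurable_funM => //; exact: measurable_cos_dot.
- by apply: filterS (fg) => x ->.
- by apply: measurable_funM => //; exact: measurable_sin_dot.
- by apply: measurable_funM => //; exact: measurable_sin_dot.
- by apply: filterS (fg) => x ->.
Qed.

(** Real and imaginary parts of [f^ = u^ + f^ ^ 2]. *)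
Lemma fourier_equation f u xi :
  mu.-integrable setT (EFin \o f) -> mu.-integrable setT (EFin \o u) ->
  {ae mu, forall x, f x = u x + convolution f f x} ->
  fourier_cos f xi =
    fourier_cos u xi + (fourier_cos f xi ^+ 2 - fourier_sin f xi ^+ 2) /\
  fourier_sin f xi = fourier_sin u xi + 2 * (fourier_cos f xi * fourier_sin f xi).
Proof.
move=> if_ iu fu.
have icf := integrable_convolution if_ if_.
have mf h : mu.-integrable setT (EFin \o h) -> measurable_fun setT h.
  by move=> ih; apply/measurable_EFinP; exact: measurable_int ih.
have [cE sE] := fourier_ae_eq xi (mf _ if_) (measurable_funD (mf _ iu) (mf _ icf)) fu.
split.
  by rewrite {1}cE fourier_cosD// fourier_cos_convolution// !expr2.
rewrite {1}sE fourier_sinD// fourier_sin_convolution//; ring.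
Qed.

(** This makes [1 - 4 u^] nonzero away from the origin. Otherwise the nonnegative function
    [u (1 - cos)] has integral at most 0, so [u] vanishes almost everywhere and its transform is 0,
    not at least 1/4. *)
Lemma fourier_cos_lt u xi : mu.-integrable setT (EFin \o u) ->
  (forall x, 0 <= u x) -> \int[mu]_x u x <= 4^-1 -> xi != 0 ->
  fourier_cos u xi < 4^-1.
Proof.
move=> iu u0 u4 xi0; rewrite ltNge; apply/negP => Cu.
pose w x := u x * (1 - cos (dot_rV xi x)).
have mu_ : measurable_fun setT u by apply/measurable_EFinP; exact: measurable_int iu.
have wE x : w x = u x - u x * cos (dot_rV xi x) by rewrite /w mulrBr mulr1.
have iw : mu.-integrable setT (EFin \o w).
  have := integrableB measurableT iu (integrable_cos_dot xi iu).
  by apply: eq_integrable => // x _; rewrite /= wE.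
have w0 x : 0 <= w x by rewrite mulr_ge0// onem_cos_ge0.
have Iw : \int[mu]_x w x <= 0.
  under eq_Rintegral do rewrite wE.
  rewrite RintegralB//; last exact: integrable_cos_dot.
  by rewrite -/(fourier_cos u xi) subr_le0 (le_trans u4).
have Iw0 : (\int[mu]_x `|(w x)%:E| = 0)%E.
  under eq_integral do rewrite gee0_abs ?lee_fin//.
  apply/eqP; rewrite eq_le integral_ge0 ?andbT; last by move=> x _; rewrite lee_fin.
  by rewrite -[leLHS]fineK ?lee_fin//; exact: integrable_fin_num.
have wae : {ae mu, forall x, w x = 0}.
  have mw : measurable_fun setT (EFin \o w) by exact: measurable_int iw.
  have [+ _] := ae_eq_integral_abs mu measurableT mw.
  by move=> /(_ Iw0); apply: filterS => x /(_ I)[].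
have uae : {ae mu, forall x, u x = 0}.
  apply: filterS2 wae (ae_sin_dot_rV_neq0 0 xi0) => x /eqP; rewrite addr0.
  rewrite mulf_eq0 => /orP[/eqP//|]; rewrite subr_eq0 eq_sym => /eqP c1.
  by rewrite cos1sin0 ?eqxx// c1 normr1.
have mz : measurable_fun setT (fun _ : 'rV[R]_n => 0 : R) by exact: measurable_cst.
have : fourier_cos u xi = 0.
  have [-> _] := fourier_ae_eq xi mu_ mz uae.
  rewrite /fourier_cos; under eq_Rintegral do rewrite mul0r.
  by rewrite Rintegral_cst// mul0r.
by move=> C0; move: Cu; rewrite C0; lra.
Qed.

(** With [t = xi . x], product-to-sum formulas would give [int h cos ^ k (t) cos (m t) = 1] for all
    [k < m]. For [m = k + 1] the integrand tends to 0 almost everywhere, and dominated convergence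
    yields [1 = 0]. *)
Lemma fourier_cos_scale_neq1 h xi : mu.-integrable setT (EFin \o h) -> xi != 0 ->
  ~ (forall r : R, 0 < r -> fourier_cos h (r *: xi) = 1).
Proof.
move=> ih xi0 H.
have mc (k m : nat) : measurable_fun setT (fun x =>
    cos (dot_rV xi x) ^+ k * cos (m%:R * dot_rV xi x)).
  apply: measurable_funM; first by apply: measurable_funX; exact: measurable_cos_dot.
  apply: (eq_measurable_fun (fun x => cos (dot_rV (m%:R *: xi) x))).
    by move=> x _; rewrite dot_rVZl.
  exact: measurable_cos_dot.
have b1 (k m : nat) x : `|cos (dot_rV xi x) ^+ k * cos (m%:R * dot_rV xi x)| <= 1.
  by rewrite normrM normrX mulr_ile1 ?exprn_ile1// ?exprn_ge0// cos_max.
(* The condition [k < m] keeps every frequency met in the recursion positive, where the assumption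
   on the ray applies. *)
have E k m : (k < m)%N ->
  \int[mu]_x (h x * (cos (dot_rV xi x) ^+ k * cos (m%:R * dot_rV xi x))) = 1.
  elim: k m => [|k IHk] m km.
    rewrite -[RHS](H m%:R) ?ltr0n//; apply: eq_Rintegral => x _.
    by rewrite expr0 mul1r dot_rVZl.
  case: m km => // m; rewrite ltnS => km.
  have cE x : h x * (cos (dot_rV xi x) ^+ k.+1 * cos (m.+1%:R * dot_rV xi x)) =
     2^-1 * (h x * (cos (dot_rV xi x) ^+ k * cos (m.+2%:R * dot_rV xi x))) +
     2^-1 * (h x * (cos (dot_rV xi x) ^+ k * cos (m%:R * dot_rV xi x))).
    move: (dot_rV xi x) => t.
    rewrite (_ : m.+2%:R * t = m.+1%:R * t + t); last by rewrite -[m.+2]addn1 natrD; ring.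
    rewrite (_ : m%:R * t = m.+1%:R * t - t); last by rewrite -[m.+1]addn1 natrD; ring.
    by rewrite exprS cosD cosB; field.
  have ii m' : mu.-integrable setT
    (EFin \o (fun x => h x * (cos (dot_rV xi x) ^+ k * cos (m'%:R * dot_rV xi x)))).
    exact: integrable_mulr_bounded ih (mc _ _) (b1 _ _).
  under eq_Rintegral do rewrite cE.
  rewrite RintegralD ?RintegralZl// ?IHk//.
  - by field.
  - by rewrite (ltn_trans km) ?ltnS ?leqnSn.
  - exact: (integrableZl measurableT _ (ii _)).
  - exact: (integrableZl measurableT _ (ii _)).
have mz : measurable_fun setT (fun _ : 'rV[R]_n => 0 : R) by exact: measurable_cst.
have L := @Rintegral_dominated_cvg _ _ _ mu h
  (fun k x => cos (dot_rV xi x) ^+ k * cos (k.+1%:R * dot_rV xi x)) (fun=> 0) ih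
  (fun k => mc k k.+1) mz (fun k => b1 k k.+1).
have : (fun=> 1 : R) @ \oo --> (0 : R).
  rewrite [X in X @ _ --> _](_ : _ = (fun k =>
    \int[mu]_x (h x * (cos (dot_rV xi x) ^+ k * cos (k.+1%:R * dot_rV xi x))))).
    rewrite [X in _ --> X](_ : 0 = \int[mu]_x (h x * (fun=> 0) x)).
      apply: L; apply: filterS (ae_sin_dot_rV_neq0 0 xi0) => x; rewrite addr0 => s0.
      apply: norm_cvg0.
      apply: (@squeeze_cvgr _ _ _ _ (fun=> 0) (fun k => `|cos (dot_rV xi x)| ^+ k)).
      - apply: nearW => k; rewrite normr_ge0 normrM normrX ler_piMr ?exprn_ge0//.
        exact: cos_max.
      - exact: cvg_cst.
      - apply: cvg_expr; rewrite normr_id lt_neqAle cos_max andbT.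
        by rewrite norm_cos_eq1.
    by under eq_Rintegral do rewrite mulr0; rewrite Rintegral_cst// mul0r.
  by apply/funext => k; rewrite E.
by move=> /cvg_lim; rewrite lim_cst// => /(_ (@Rhausdorff R))/eqP; rewrite oner_eq0.
Qed.

End convolution_equation.

(** * Comparison of two solutions along rays *)

Section uniqueness.
Context {R : realType} (n : nat).
Local Notation mu := (@lebesgue_rV R n).
Implicit Types (f g u : 'rV[R]_n -> R) (xi x : 'rV[R]_n).

Lemma continuous_fourier_cos_ray f xi : mu.-integrable setT (EFin \o f) ->
  continuous (fun r : R => fourier_cos f (r *: xi)).
Proof.
move=> if_; rewrite (_ : (fun r => _) =
  (fun r => \int[mu]_x (f x * cos (r * dot_rV xi x)))).
  apply: continuous_Rintegral_comp => //.
  - exact: continuous_cos.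
  - exact: cos_max.
  - exact: measurable_dot_rV.
by apply/funext => r; apply: eq_Rintegral => x _; rewrite dot_rVZl.
Qed.

Lemma continuous_fourier_sin_ray f xi : mu.-integrable setT (EFin \o f) ->
  continuous (fun r : R => fourier_sin f (r *: xi)).
Proof.
move=> if_; rewrite (_ : (fun r => _) =
  (fun r => \int[mu]_x (f x * sin (r * dot_rV xi x)))).
  apply: continuous_Rintegral_comp => //.
  - exact: continuous_sin.
  - exact: sin_max.
  - exact: measurable_dot_rV.
by apply/funext => r; apply: eq_Rintegral => x _; rewrite dot_rVZl.
Qed.

Lemma continuous_eq_at0 (E1 E2 : R -> R) : continuous E1 -> continuous E2 ->
  (forall r, 0 < r -> E1 r = E2 r) -> E1 0 = E2 0.
Proof.
move=> c1 c2 E12.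
have h1 : E1 (harmonic k) @[k --> \oo] --> E1 0.
  exact: (cvg_comp (@harmonic R) E1 cvg_harmonic (c1 0)).
have h2 : E2 (harmonic k) @[k --> \oo] --> E2 0.
  exact: (cvg_comp (@harmonic R) E2 cvg_harmonic (c2 0)).
have e : (fun k => E1 (harmonic k)) = (fun k => E2 (harmonic k)).
  by apply/funext => k; apply: E12; rewrite /harmonic /= invr_gt0 ltr0n.
by rewrite e in h1; rewrite -(cvg_lim _ h1)// (cvg_lim _ h2).
Qed.

Lemma continuous_subM2 (F : R -> R) (a : R) : continuous F ->
  continuous (fun r => a - 2 * F r).
Proof.
move=> cF r; apply: cvgB; first exact: cvg_cst.
by apply: cvgM; [exact: cvg_cst|exact: cF].
Qed.

(** At frequency 0 the equation reads [a = b + a ^ 2], that is, [b = 1/4 - (a - 1/2) ^ 2]. *)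
Lemma mass_le_quarter f u : 
  mu.-integrable setT (EFin \o f) -> mu.-integrable setT (EFin \o u) ->
  {ae mu, forall x, f x = u x + convolution f f x} ->
  \int[mu]_x u x <= 4^-1.
Proof.
move=> if_ iu fu; have [+ _] := fourier_equation 0 if_ iu fu.
rewrite !fourier_cos0 fourier_sin0; move: (\int[mu]_x f x) (\int[mu]_x u x) => a b.
have := sqr_ge0 (a - 2^-1); nra.
Qed.

Lemma solution_unique f g u : (0 < n)%N ->
  mu.-integrable setT (EFin \o f) -> mu.-integrable setT (EFin \o g) ->
  mu.-integrable setT (EFin \o u) -> (forall x, 0 <= u x) ->
  {ae mu, forall x, f x = u x + convolution f f x} ->
  {ae mu, forall x, g x = u x + convolution g g x} ->
  {ae mu, forall x, f x = g x}.
Proof.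
move=> n0 if_ ig iu u0 fu gu.
have u4 := mass_le_quarter if_ iu fu.
have ray xi : xi != 0 -> forall r, 0 < r ->
    fourier_cos f (r *: xi) = fourier_cos g (r *: xi) /\
    fourier_sin f (r *: xi) = fourier_sin g (r *: xi).
  move=> xi0.
  (* The two functions are [1 - 2 f^] and [1 - 2 g^], both with square [1 - 4 u^]. The imaginary
     parts are written [0 - 2 * _] to fit [continuous_subM2]. *)
  have [||||r r0|r r0|r r0|H|H] := @square_root_branch R
    (fun r => 1 - 2 * fourier_cos f (r *: xi)) (fun r => 0 - 2 * fourier_sin f (r *: xi))
    (fun r => 1 - 2 * fourier_cos g (r *: xi)) (fun r => 0 - 2 * fourier_sin g (r *: xi)).
  - exact/continuous_subM2/continuous_fourier_cos_ray.
  - exact/continuous_subM2/continuous_fourier_sin_ray.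
  - exact/continuous_subM2/continuous_fourier_cos_ray.
  - exact/continuous_subM2/continuous_fourier_sin_ray.
  - have [e1 _] := fourier_equation (r *: xi) if_ iu fu.
    have [e2 _] := fourier_equation (r *: xi) ig iu gu.
    by move: e1 e2; nra.
  - have [_ e1] := fourier_equation (r *: xi) if_ iu fu.
    have [_ e2] := fourier_equation (r *: xi) ig iu gu.
    by move: e1 e2; nra.
  (* The real part alone never vanishes: a cosine transform of [g] equal to 1/2 would make that of
     [u] equal to 1/4 plus a square. *)
  - apply/orP; left; apply/eqP => T0.
    have [e2 _] := fourier_equation (r *: xi) ig iu gu.
    have rxi0 : r *: xi != 0 by rewrite scaler_eq0 negb_or xi0 gt_eqF.
    have := fourier_cos_lt iu u0 u4 rxi0.
    have := sqr_ge0 (fourier_sin g (r *: xi)).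
    by move: e2 T0; nra.
  - by move=> r r0; have [e1 e2] := H r r0; split; lra.
  (* On the opposite branch the cosine transforms of [f] and [g] add up to 1 along the whole ray. *)
  - exfalso; apply: (fourier_cos_scale_neq1 (integrableD measurableT if_ ig) xi0) => r r0.
    rewrite fourier_cosD//; have [e1 _] := H r r0; lra.
apply: fourier_injective => // xi; have [->|xi0] := eqVneq xi 0.
(* The origin lies on no open ray; it is reached by continuity along a coordinate direction, which
   exists since [0 < n]. *)
- pose e : 'rV[R]_n := delta_mx ord0 (Ordinal n0).
  have e0 : e != 0.
    by apply/eqP => /matrixP/(_ ord0 (Ordinal n0))/eqP; rewrite !mxE !eqxx oner_eq0.
  have := continuous_eq_at0 (continuous_fourier_cos_ray (xi := e) if_)
    (continuous_fourier_cos_ray (xi := e) ig).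
  by rewrite !scale0r; apply => r r0; have [] := ray e e0 r r0.
- by rewrite -[xi]scale1r; have [] := ray xi xi0 1 ltr01.
- by rewrite !fourier_sin0.
- by rewrite -[xi]scale1r; have [] := ray xi xi0 1 ltr01.
Qed.

End uniqueness.

(** * Linear bound on the oscillation of the nonnegative solution *)

Section oscillation_bound.
Context {R : realType} (n : nat).
Local Notation mu := (@lebesgue_rV R n).
Implicit Types (g u : 'rV[R]_n -> R) (x : 'rV[R]_n).

(* With [T = A + i B], [|T - A0| <= |T + A0|] because [A] and [A0] are nonnegative,
   whence [|T - A0| ^ 2 <= |T ^ 2 - A0 ^ 2|]. *)
Lemma sqrt_perturbation (A A0 B E : R) : 0 <= A -> 0 <= A0 ->
  `|A ^+ 2 - B ^+ 2 - A0 ^+ 2| <= 4 * E -> `|2 * (A * B)| <= 4 * E ->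
  (A - A0) ^+ 2 <= 6 * E.
Proof.
move=> A_ge0 A0_ge0 hre him.
have E0 : 0 <= E by have := le_trans (normr_ge0 _) hre; lra.
set y := _ - _ - _ in hre; set z := 2 * _ in him.
have y2 : y ^+ 2 <= 16 * E ^+ 2.
  by rewrite -real_normK ?num_real//; move: hre (normr_ge0 y); nra.
have z2 : z ^+ 2 <= 16 * E ^+ 2.
  by rewrite -real_normK ?num_real//; move: him (normr_ge0 z); nra.
set X := (A - A0) ^+ 2 + B ^+ 2.
have X0 : 0 <= X by rewrite addr_ge0// sqr_ge0.
have XE : (A - A0) ^+ 2 <= X by rewrite lerDl sqr_ge0.
apply: (le_trans XE).
have XX : X ^+ 2 <= y ^+ 2 + z ^+ 2.
  rewrite (_ : y ^+ 2 + z ^+ 2 = X * (X + 4 * (A * A0))); last by rewrite /y /z /X; ring.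
  by rewrite expr2 ler_wpM2l// lerDl !mulr_ge0.
by nra.
Qed.

(** Let [T = 1 - 2 g^] at frequency [k e_i] and [A0 = 1 - 2 a] with [a = int g]. Then
    [T ^ 2 - A0 ^ 2] is four times the variation of [u^] from the origin, of order [k ^ 2], and
    [sqrt_perturbation] halves the order. Its sign conditions hold because [g^] has real part at
    most [a <= 1/2]. *)
Lemma fourier_oscillation_le g u (i : 'I_n) :
  mu.-integrable setT (EFin \o g) -> (forall x, 0 <= g x) ->
  \int[mu]_x g x <= 2^-1 ->
  mu.-integrable setT (EFin \o u) -> (forall x, 0 <= u x) ->
  mu.-integrable setT (EFin \o (fun x => x ord0 i ^+ 2 * u x)) ->
  mu.-integrable setT (EFin \o (fun x => x ord0 i * u x)) ->
  \int[mu]_x (x ord0 i * u x) = 0 ->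
  {ae mu, forall x, g x = u x + convolution g g x} ->
  exists2 K : R, 0 <= K &
    forall k : R, \int[mu]_x (g x * (1 - cos (k * x ord0 i))) <= K * `|k|.
Proof.
move=> ig g0 g2 iu u0 iu2 iu1 u1 gu.
pose M := \int[mu]_x (x ord0 i ^+ 2 * u x).
have M0 : 0 <= M by apply: Rintegral_ge0 => x _; rewrite mulr_ge0 ?sqr_ge0.
(* The final estimate is [4 (a - C) ^ 2 <= 6 M k ^ 2], and [3/2 M <= (M + 1) ^ 2]. *)
exists (M + 1) => [|k]; first by rewrite addr_ge0.
pose xi : 'rV[R]_n := k *: delta_mx ord0 i.
have dE x : dot_rV xi x = k * x ord0 i by rewrite dot_rVZl dot_rV_delta.
have diffE h : mu.-integrable setT (EFin \o h) ->
    \int[mu]_x (h x * (1 - cos (k * x ord0 i))) = \int[mu]_x h x - fourier_cos h xi.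
  move=> ih; rewrite -RintegralB//; last exact: integrable_cos_dot.
  by apply: eq_Rintegral => x _; rewrite mulrBr mulr1 dE.
have int_onem h : mu.-integrable setT (EFin \o h) ->
    mu.-integrable setT (EFin \o (fun x => h x * (1 - cos (k * x ord0 i)))).
  move=> ih; have := integrableB measurableT ih (integrable_cos_dot xi ih).
  by apply: eq_integrable => // x _; rewrite /= dE mulrBr mulr1.
have [eC eS] := fourier_equation xi ig iu gu.
have [eC0 _] := fourier_equation 0 ig iu gu.
rewrite !fourier_cos0 fourier_sin0 in eC0.
have Cle : 0 <= \int[mu]_x g x - fourier_cos g xi.
  rewrite -diffE//; apply: Rintegral_ge0 => x _.
  by rewrite mulr_ge0// onem_cos_ge0.
have cle : 0 <= \int[mu]_x u x - fourier_cos u xi.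
  rewrite -diffE//; apply: Rintegral_ge0 => x _.
  by rewrite mulr_ge0// onem_cos_ge0.
have iM : mu.-integrable setT (EFin \o (fun x => k ^+ 2 * (x ord0 i ^+ 2 * u x))).
  exact: (integrableZl measurableT (k ^+ 2) iu2).
have cM : \int[mu]_x u x - fourier_cos u xi <= M * k ^+ 2.
  rewrite -diffE// mulrC -RintegralZl//; apply: le_Rintegral => //; first exact: int_onem.
  move=> x _; rewrite mulrA -exprMn mulrC ler_wpM2r//; exact: onem_cos_le_sqr.
(* As [u] is centered, [k x_i u] can be subtracted for free; the remainder [sin t - t] is
   quadratic. *)
have sM : `|fourier_sin u xi| <= M * k ^+ 2.
  have ik : mu.-integrable setT (EFin \o (fun x => k * (x ord0 i * u x))).
    exact: (integrableZl measurableT k iu1).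
  have -> : fourier_sin u xi =
      \int[mu]_x (u x * sin (dot_rV xi x) - k * (x ord0 i * u x)).
    by rewrite RintegralB ?RintegralZl ?u1 ?mulr0 ?subr0//; exact: integrable_sin_dot.
  have is_ : mu.-integrable setT
      (EFin \o (fun x => u x * sin (dot_rV xi x) - k * (x ord0 i * u x))).
    exact: (integrableB measurableT (integrable_sin_dot xi iu) ik).
  apply: (le_trans (le_normr_Rintegral measurableT is_)).
  rewrite mulrC -RintegralZl//; apply: le_Rintegral => //; first exact: integrable_norm.
  move=> x _; rewrite dE mulrA (mulrC (u x)) -mulrBl normrM (ger0_norm (u0 x)).
  by rewrite [leRHS]mulrA -exprMn ler_wpM2r//; exact: norm_sinB_le_sqr.
rewrite diffE//.
move: eC eS eC0 Cle cle cM sM g2.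
move: (\int[mu]_x g x) (\int[mu]_x u x) (fourier_cos g xi) (fourier_sin g xi)
  (fourier_cos u xi) (fourier_sin u xi) => a b C S c s eC eS eC0 Cle cle cM sM g2.
have := @sqrt_perturbation (1 - 2 * C) (1 - 2 * a) (2 * S) (M * k ^+ 2).
rewrite (_ : _ - _ - _ = 4 * (b - c)); last by nra.
rewrite (_ : 2 * (_ * (2 * S)) = 4 * s); last by nra.
rewrite !normrM [`|4|]ger0_norm// (ger0_norm cle) !ler_pM2l//.
move=> /(_ _ _ cM sM) H.
have {}H : 4 * (a - C) ^+ 2 <= 6 * (M * k ^+ 2).
  rewrite (_ : 4 * _ = (1 - 2 * C - (1 - 2 * a)) ^+ 2); last by ring.
  by apply: H; lra.
have k2 : `|k| ^+ 2 = k ^+ 2 by rewrite real_normK ?num_real.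
rewrite -(@ler_pXn2r _ 2) ?nnegrE//; last by rewrite mulr_ge0 ?addr_ge0.
rewrite exprMn k2; have := sqr_ge0 k; nra.
Qed.

End oscillation_bound.

(** * Moments *)

Section moments.
Context {R : realType} (n : nat).
Local Notation mu := (@lebesgue_rV R n).
Implicit Types (g : 'rV[R]_n -> R) (x : 'rV[R]_n).

Lemma measurable_enorm : measurable_fun setT (@enorm R n).
Proof.
have ms : measurable_fun setT (@Num.sqrt R).
  by apply: continuous_measurable_fun; exact: sqrt_continuous.
apply: (measurableT_comp ms); apply: measurable_sum => i.
by apply: measurable_funX; exact: measurable_coord_rV.
Qed.

(** The index is that of a coordinate of largest modulus. The factor [n] is cruder than [sqrt n] but
    sufficient. *)
Lemma enorm_le_max x : (0 < n)%N -> exists i, enorm x <= n%:R * `|x ord0 i|.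
Proof.
move=> n0; pose i := [arg max_(j > Ordinal n0) `|x ord0 j|]%O.
exists i; have imax j : `|x ord0 j| <= `|x ord0 i|.
  by rewrite /i; case: arg_maxP => // k _ /(_ j isT).
rewrite -[leRHS]ger0_norm ?mulr_ge0// -sqrtr_sqr ler_wsqrtr//.
apply: (@le_trans _ _ (\sum_(j < n) `|x ord0 i| ^+ 2)).
  apply: ler_sum => j _; rewrite -real_normK ?num_real// lerXn2r ?nnegrE//.
rewrite sumr_const card_ord exprMn -[leLHS]mulr_natl ler_wpM2r ?sqr_ge0//.
by rewrite -natrX ler_nat -mulnn leq_pmull.
Qed.

(* Take [m] with [2 ^ m <= |t| < 2 ^ m.+1]. *)
Lemma powR_le_dyadic (p t : R) : 0 <= p <= 1 -> 1 <= `|t| ->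
  exists m : nat,
    `|t| `^ p <= 2 / (1 - cos 1) * ((2 `^ p) ^+ m * (1 - cos (2 ^- m * t))).
Proof.
move=> /andP[p0 p1] t1; set k := Num.truncn `|t|; pose m := trunc_log 2 k.
have /andP[kl ku] := truncn_itv (normr_ge0 t).
have k0 : (0 < k)%N by rewrite truncn_gt0.
have /andP[ml mu_] := trunc_log_bounds (isT : (1 < 2)%N) k0.
have lo : 2 ^+ m <= `|t|.
  by apply: le_trans kl; rewrite -natrX ler_nat.
have hi : `|t| <= 2 ^+ m.+1.
  by apply: (le_trans (ltW ku)); rewrite -natrX ler_nat.
exists m.
have c0 := @onem_cos1_gt0 R.
have hc : 1 - cos 1 <= 1 - cos (2 ^- m * t).
  apply: onem_cos_ge; rewrite normrM ger0_norm ?invr_ge0 ?exprn_ge0//.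
  by rewrite mulrC ler_pdivlMr ?exprn_gt0// mul1r lo ler_pdivrMr ?exprn_gt0// -exprS.
have b0 : 0 <= (2 `^ p) ^+ m by rewrite exprn_ge0// powR_ge0.
have b2 : 2 `^ p <= 2 by rewrite -[leRHS]powRr1// ler_powR// ler1n.
(* The upper bound [|t| <= 2 ^ (m + 1)] costs one extra factor [2 ^ p <= 2], which is the 2 in the
   constant. *)
apply: (@le_trans _ _ ((2 `^ p) ^+ m.+1)).
  rewrite -powR_mulrn ?powR_ge0// -powRrM mulrC powRrM powR_mulrn//.
  by rewrite ge0_ler_powR// nnegrE ?exprn_ge0.
rewrite exprS; apply: (@le_trans _ _ (2 * (2 `^ p) ^+ m)).
  by rewrite ler_wpM2r.
rewrite [leLHS](_ : _ = 2 / (1 - cos 1) * ((2 `^ p) ^+ m * (1 - cos 1))).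
  by rewrite ler_wpM2l ?ler_wpM2l// divr_ge0// ltW.
by field; rewrite gt_eqF.
Qed.

(** The weight is dominated pointwise by a constant plus a series of dyadic oscillations. At scale
    [2 ^ -m] the oscillation bound gains [2 ^ -m] against the weight [2 ^ (m p)], which leaves a
    geometric series of ratio [2 ^ (p - 1) < 1]. *)
Lemma moment_lty g (p : R) : (0 < n)%N -> 0 <= p < 1 ->
  mu.-integrable setT (EFin \o g) -> (forall x, 0 <= g x) ->
  (forall i : 'I_n, exists2 K : R, 0 <= K &
    forall k : R, \int[mu]_x (g x * (1 - cos (k * x ord0 i))) <= K * `|k|) ->
  (\int[mu]_x (enorm x `^ p * g x)%:E < +oo)%E.
Proof.
move=> n0 /andP[p0 p1] ig g0 HK.
have mg : measurable_fun setT g by apply/measurable_EFinP; exact: measurable_int ig.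
have {HK}[K K0 HK] : exists2 K : 'I_n -> R, forall i, 0 <= K i &
    forall i (k : R), \int[mu]_x (g x * (1 - cos (k * x ord0 i))) <= K i * `|k|.
  have /choice[K HK'] : forall i, exists K, 0 <= K /\
      forall k : R, \int[mu]_x (g x * (1 - cos (k * x ord0 i))) <= K * `|k|.
    by move=> i; have [K K0 KP] := HK i; exists K.
  by exists K => i; have [] := HK' i.
pose b : R := 2 `^ p.
have b0 : 0 <= b by exact: powR_ge0.
have b2 : b < 2.
  have q1 : 1 < 2 `^ (1 - p) :> R.
    rewrite lt_neqAle eq_sym powR_eq1 pnatr_eq1 ltrn0 subr_eq0 (gt_eqF p1)/=.
    by rewrite -[leLHS](powRr0 (2 : R)) ler_powR ?ler1n// subr_ge0 ltW.
  have -> : 2 = b * 2 `^ (1 - p).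
    by rewrite -powRD ?pnatr_eq0 ?implybT// addrC subrK powRr1.
  by rewrite ltr_pMr// powR_gt0.
have c0 := @onem_cos1_gt0 R.
pose C : R := 2 / (1 - cos 1).
have C0 : 0 <= C by rewrite divr_ge0// ltW.
pose D : R := n%:R `^ p.
have D0 : 0 <= D by exact: powR_ge0.
pose h i m x := g x * (1 - cos (2 ^- m * x ord0 i)).
have h0 i m x : 0 <= h i m x by rewrite mulr_ge0// onem_cos_ge0.
have ih i m : mu.-integrable setT (EFin \o h i m).
  have := integrableB measurableT ig (integrable_cos_dot (2 ^- m *: delta_mx ord0 i) ig).
  apply: eq_integrable => // x _.
  by rewrite /= dot_rVZl dot_rV_delta /h mulrBr mulr1.
pose w m x := D * (C * (b ^+ m * \sum_(i < n) h i m x)).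
have w0 m x : 0 <= w m x.
  by rewrite /w !mulr_ge0 ?exprn_ge0 ?sumr_ge0.
have mw m : measurable_fun setT (w m).
  apply: measurable_funM => //; apply: measurable_funM => //.
  apply: measurable_funM => //; apply: measurable_sum => i.
  by apply/measurable_EFinP; exact: measurable_int (ih i m).
(* If the largest coordinate has modulus at least 1, a single term of the series suffices; otherwise
   the weight is at most [D = n ^ p]. *)
have pointwise x : ((enorm x `^ p * g x)%:E <=
    (D * g x)%:E + \sum_(m <oo) (w m x)%:E)%E.
  have [i ile] := enorm_le_max x n0.
  have step1 : enorm x `^ p <= D * `|x ord0 i| `^ p.
    by rewrite -powRM// ge0_ler_powR// nnegrE ?mulr_ge0// sqrtr_ge0.
  have [x1|x1] := leP 1 `|x ord0 i|.
    have p01 : 0 <= p <= 1 by rewrite p0 ltW.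
    have [m] := powR_le_dyadic p01 x1; rewrite -/C -/b => hm.
    apply: (@le_trans _ _ (w m x)%:E).
      rewrite lee_fin /w (le_trans (ler_wpM2r (g0 x) step1))// -mulrA ler_wpM2l//.
      apply: (le_trans (ler_wpM2r (g0 x) hm)).
      rewrite [leLHS](_ : _ = C * (b ^+ m * h i m x)); last by rewrite /h; ring.
      rewrite ler_wpM2l// ler_wpM2l ?exprn_ge0//.
      by rewrite (bigD1 i)//= lerDl sumr_ge0.
    apply: (@le_trans _ _ (\sum_(m <oo) (w m x)%:E)%E).
      rewrite (@nneseriesD1 _ _ m xpredT)//; last by move=> k _; rewrite lee_fin.
      by rewrite leeDl// nneseries_ge0// => k _ _; rewrite lee_fin.
    by rewrite leeDr// lee_fin mulr_ge0.
  apply: (@le_trans _ _ (D * g x)%:E); last first.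
    by rewrite leeDl// nneseries_ge0// => k _ _; rewrite lee_fin.
  rewrite lee_fin ler_wpM2r// (le_trans step1)// ler_piMr//.
  apply: (@le_trans _ _ (1 `^ p)); last by rewrite powR1.
  by rewrite ge0_ler_powR// ?nnegrE// ltW.
have iDg : mu.-integrable setT (fun x => (D * g x)%:E) := integrableZl measurableT D ig.
have S0 : 0 <= \sum_(i < n) K i by rewrite sumr_ge0.
pose S := D * (C * (\sum_(i < n) K i)).
have S_ge0 : 0 <= S by rewrite !mulr_ge0.
have int_w m : (\int[mu]_x (w m x)%:E <= (S * (b / 2) ^+ m)%:E)%E.
  have wE x : (w m x)%:E = ((D * (C * b ^+ m))%:E * \sum_(i < n) (h i m x)%:E)%E.
    by rewrite sumEFin -EFinM /w; congr EFin; ring.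
  under eq_integral do rewrite wE.
  have c_ge0 : 0 <= D * (C * b ^+ m) by rewrite !mulr_ge0 ?exprn_ge0.
  rewrite ge0_integralZl//; last 2 first.
  - by apply: emeasurable_sum => i; exact: measurable_int (ih i m).
  - by move=> x _; apply: sume_ge0 => i _; rewrite lee_fin.
  rewrite ge0_integral_sum//; last 2 first.
  - by move=> i; exact: measurable_int (ih i m).
  - by move=> i x _; rewrite lee_fin.
  apply: (@le_trans _ _ ((D * (C * b ^+ m))%:E * \sum_(i < n) (K i * 2 ^- m)%:E)%E).
    rewrite lee_wpmul2l ?lee_fin//; apply: lee_sum => i _.
    rewrite -[leLHS]fineK; last exact: (integrable_fin_num measurableT (ih i m)).
    rewrite lee_fin (le_trans (HK i (2 ^- m)))// ger0_norm// invr_ge0 exprn_ge0//.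
  rewrite sumEFin -EFinM lee_fin /S -mulr_suml expr_div_n.
  by rewrite le_eqVlt; apply/orP; left; apply/eqP; ring.
apply: (@le_lt_trans _ _ (\int[mu]_x ((D * g x)%:E + \sum_(m <oo) (w m x)%:E))%E).
  apply: ge0_le_integral => //.
  - by move=> x _; rewrite lee_fin mulr_ge0// powR_ge0.
  - apply/measurable_EFinP/measurable_funM => //.
    exact: (measurableT_comp (measurable_powR p) measurable_enorm).
  - apply: emeasurable_funD; first exact: measurable_int iDg.
    by apply: ge0_emeasurable_sum => [k x _ _|k _]; [rewrite lee_fin|exact/measurable_EFinP].
rewrite ge0_integralD//; last 4 first.
- by move=> x _; rewrite lee_fin mulr_ge0.
- exact: measurable_int iDg.
- by move=> x _; rewrite nneseries_ge0// => k _ _; rewrite lee_fin.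
- by apply: ge0_emeasurable_sum => [k x _ _|k _]; [rewrite lee_fin|exact/measurable_EFinP].
rewrite integral_nneseries//; last 2 first.
- by move=> k; exact/measurable_EFinP.
- by move=> k x _; rewrite lee_fin.
apply: lte_add_pinfty; first exact: (integrable_lty measurableT iDg).
apply: (@le_lt_trans _ _ (S / (1 - b / 2))%:E); last exact: ltry.
have z1 : 0 < 1 - b / 2 by lra.
apply: lime_le.
  by apply: is_cvg_nneseries => k _ _; apply: integral_ge0 => x _; rewrite lee_fin.
apply: nearW => N; apply: (@le_trans _ _ (\sum_(0 <= m < N) (S * (b / 2) ^+ m)%:E)%E).
  by apply: lee_sum => m _; exact: int_w.
rewrite sumEFin lee_fin -mulr_sumr ler_wpM2l//.
rewrite -[leRHS]mul1r ler_pdivlMr//.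
(* Finite geometric sum, multiplied out to avoid division. *)
suff -> : (\sum_(0 <= m < N) (b / 2) ^+ m) * (1 - b / 2) = 1 - (b / 2) ^+ N.
  by rewrite gerBl exprn_ge0// divr_ge0.
elim: N => [|N IHN]; first by rewrite big_geq// mul0r expr0 subrr.
by rewrite big_nat_recr//= mulrDl IHN exprS; ring.
Qed.

End moments.

(** * Transfer of the moment bound from the nonnegative solution to [f] *)

Theorem theorem3 (R : realType) (d : nat) (f : 'rV[R]_d -> R)
    (u := fun x : 'rV[R]_d => f x - convolution f f x) :
  (1 <= d)%N ->
  (lebesgue_rV d).-integrable setT (EFin \o f) ->
  {ae lebesgue_rV d, forall x, 0 <= u x} ->
  (\int[lebesgue_rV d]_x (enorm x ^+ 2 * u x)%:E < +oo)%E ->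
  (forall i : 'I_d, (\int[lebesgue_rV d]_x (x ord0 i * u x)%:E = 0)%E) ->
  forall p : R, 0 <= p < 1 ->
    (\int[lebesgue_rV d]_x (enorm x `^ p * f x)%:E < +oo)%E.
Proof.
move=> d0 if_ u0 u2 u1 p p01.
have iu : (lebesgue_rV d).-integrable setT (EFin \o u).
  exact: (integrableB measurableT if_ (integrable_convolution if_ if_)).
have mu_ : measurable_fun setT u by apply/measurable_EFinP; exact: measurable_int iu.
have mf : measurable_fun setT f by apply/measurable_EFinP; exact: measurable_int if_.
(* [v] agrees with [u] almost everywhere and is nonnegative at every point, as the construction of
   the solution requires. *)
pose v (x : 'rV[R]_d) := `|u x|.
have mv : measurable_fun setT v by exact: measurableT_comp.
have iv : (lebesgue_rV d).-integrable setT (EFin \o v) by exact: (integrable_norm iu).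
have v0 x : 0 <= v x by exact: normr_ge0.
have uv : {ae lebesgue_rV d, forall x, u x = v x}.
  by apply: filterS u0 => x ux; rewrite /v ger0_norm.
have fv : {ae lebesgue_rV d, forall x, f x = v x + convolution f f x}.
  by apply: filterS (uv) => x <-; rewrite /u subrK.
have mcoord i : measurable_fun setT (fun x : 'rV[R]_d => x ord0 i).
  exact: measurable_coord_rV.
have vE (w : 'rV[R]_d -> R) : measurable_fun setT w ->
    (\int[lebesgue_rV d]_x (w x * u x)%:E = \int[lebesgue_rV d]_x (w x * v x)%:E)%E.
  move=> mw; apply: ae_eq_integral => //.
  - by apply/measurable_EFinP/measurable_funM.
  - by apply/measurable_EFinP/measurable_funM.
  - by apply: filterS (uv) => x -> _.
have iv2 (i : 'I_d) : (lebesgue_rV d).-integrable setT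
    (EFin \o (fun x : 'rV[R]_d => x ord0 i ^+ 2 * v x)).
  have msq : measurable_fun setT (fun x : 'rV[R]_d => x ord0 i ^+ 2).
    exact: measurable_funX.
  have men : measurable_fun setT (fun x : 'rV[R]_d => enorm x ^+ 2).
    by apply: measurable_funX; exact: measurable_enorm.
  apply/integrableP; split; first by apply/measurable_EFinP/measurable_funM.
  apply: le_lt_trans u2; rewrite vE//; apply: ge0_le_integral => //.
  - by apply: measurableT_comp => //; apply/measurable_EFinP/measurable_funM.
  - by apply/measurable_EFinP/measurable_funM.
  - move=> x _; rewrite /= lee_fin ger0_norm; last by rewrite mulr_ge0 ?sqr_ge0.
    rewrite ler_wpM2r// /enorm sqr_sqrtr; last by rewrite sumr_ge0// => j _; rewrite sqr_ge0.
    by rewrite (bigD1 i)//= lerDl sumr_ge0// => j _; rewrite sqr_ge0.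
have iv1 (i : 'I_d) : (lebesgue_rV d).-integrable setT
    (EFin \o (fun x : 'rV[R]_d => x ord0 i * v x)).
  (* First moments are controlled by [|t| <= 1 + t ^ 2]. *)
  have := integrableD measurableT iv (iv2 i).
  apply: le_integrable => //; first by apply/measurable_EFinP/measurable_funM.
  move=> x _; rewrite /= lee_fin normrM (ger0_norm (v0 x)).
  rewrite [leRHS]ger0_norm; last by rewrite addr_ge0// mulr_ge0 ?sqr_ge0.
  rewrite -{2}[v x]mul1r -mulrDl ler_wpM2r//.
  rewrite -[x ord0 i ^+ 2]real_normK ?num_real//.
  by have := sqr_ge0 (`|x ord0 i| - 2^-1); nra.
have v4 : (\int[lebesgue_rV d]_x (v x)%:E <= (4^-1)%:E)%E.
  rewrite -[leLHS]fineK; last exact: (integrable_fin_num measurableT iv).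
  by rewrite lee_fin; exact: mass_le_quarter if_ iv fv.
(* From here [f] is replaced by [g], equal to it almost everywhere, nonnegative at every point and
   of mass at most 1/2, which selects the right square root. *)
have [g [g0 ig g2 gv]] := exists_nonneg_solution mv v0 v4.
have fg := solution_unique d0 if_ ig iv v0 fv gv.
have mg : measurable_fun setT g by apply/measurable_EFinP; exact: measurable_int ig.
have mp : measurable_fun setT (fun x : 'rV[R]_d => enorm x `^ p).
  exact: (measurableT_comp (measurable_powR p) (@measurable_enorm R d)).
rewrite (ae_eq_integral (fun x : 'rV[R]_d => (enorm x `^ p * g x)%:E))//; first last.
- by apply: filterS fg => x -> _.
- by apply/measurable_EFinP/measurable_funM.
- by apply/measurable_EFinP/measurable_funM.
apply: moment_lty => // i.
apply: (fourier_oscillation_le ig g0 g2 iv v0 (iv2 i) (iv1 i) _ gv).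
by rewrite /Rintegral -vE// u1.
Qed.
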